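(* Let $f$ be a transcendental entire function and let $L_R$ be a fundamental loop of $f$. Then either $L_R\subset F(f)$ or $L_R\subset J(f)$.
   Context: Let $f$ be a transcendental entire function. The Fatou set $F(f)$ is the set of points having a neighbourhood on which $(f^n)_{n\in\mathbb N}$ is a normal family, and the Julia set is $J(f)=\mathbb C\setminus F(f)$. Here $\mathbb{N}=\{1,2,\dots\}$. $M(r)=M(r,f)=\max_{|z|=r}|f(z)|$ for $r\ge 0$, and $M^n(r)$ denotes the $n$-th iterate of $r\mapsto M(r)$. For $R>0$ such that $M^n(R)\to\infty$ as $n\to\infty$ (a restriction on $R$ assumed throughout), put $A_R(f)=\{z: |f^n(z)|\ge M^n(R),\ n\in\mathbb N\}$. A set $E\subset\mathbb C$ is a spider's web if $E$ is connected and there is a sequence $(G_n)_{n\in\mathbb N}$ of bounded simply connected domains with $\partial G_n\subset E$, $G_n\subset G_{n+1}$ for $n\in\mathbb N$, and $\bigcup_n G_n=\mathbb C$. When $A_R(f)$ is a spider's web, the fundamental hole $H_R$ is the component of $\mathbb C\setminus A_R(f)$ that contains the origin, and the fundamental loop is $L_R=\partial H_R$. Thus ''$L_R$ is a fundamental loop of $f$'' means that $R>0$ is such that $M^n(R)\to\infty$ as $n\to\infty$, $A_R(f)$ is a spider's web, and $L_R=\partial H_R$. *)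

(* Defs.v *)
From HB Require Import structures.
From mathcomp Require Import all_boot all_order all_algebra.
From mathcomp Require Import complex.
From mathcomp Require Import all_classical all_reals all_analysis.

Set Implicit Arguments.
Unset Strict Implicit.
Unset Printing Implicit Defensive.

Import Order.TTheory GRing.Theory Num.Theory.
Import numFieldNormedType.Exports.

Local Open Scope classical_set_scope.
Local Open Scope ring_scope.
Local Open Scope complex_scope.

(* The complex plane, packed as a numClosedFieldType: the topology, norm and
   normed-module structure are then the generic ones of
   [numFieldNormedType], and [derivable f z 1] is complex differentiability. *)
Definition CC (R : realType) : numClosedFieldType := R[i].

(* The norm `|z| of MathComp lives in CC R; this is the R-valued modulus. *)
Definition modulus (R : realType) (z : CC R) : R := ComplexField.Normc.normc z.

Definition entire (R : realType) (f : CC R -> CC R) : Prop :=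
  forall z : CC R, derivable f z 1.

Definition transcendental_entire (R : realType) (f : CC R -> CC R) : Prop :=
  entire f /\ ~ exists p : {poly CC R}, forall z, f z = p.[z].

(* The Riemann sphere is [option (CC R)], with [None] the point at infinity. *)
Definition chordal (R : realType) (a b : option (CC R)) : R :=
  match a, b with
  | Some z, Some w =>
      2 * modulus (z - w) /
        (Num.sqrt (1 + modulus z ^+ 2) * Num.sqrt (1 + modulus w ^+ 2))
  | Some z, None | None, Some z => 2 / Num.sqrt (1 + modulus z ^+ 2)
  | None, None => 0
  end.

Definition cvg_locally_uniformly (R : realType) (U : set (CC R))
    (u : nat -> CC R -> CC R) (g : CC R -> option (CC R)) : Prop :=
  forall z, U z -> exists2 V : set (CC R), nbhs z V &
    forall e : R, 0 < e ->
      \forall n \near \oo, forall w, (U `&` V) w ->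
        chordal (Some (u n w)) (g w) < e.

(* Normality is taken with respect to the spherical metric, so that locally
   uniform convergence to infinity is allowed. *)
Definition normal_family (R : realType) (U : set (CC R))
    (F : set (CC R -> CC R)) : Prop :=
  forall u : nat -> CC R -> CC R, (forall n, F (u n)) ->
    exists2 k : nat -> nat, {homo k : m n / (m < n)%N} &
      exists g : CC R -> option (CC R), cvg_locally_uniformly U (u \o k) g.

Definition iterates (R : realType) (f : CC R -> CC R) : set (CC R -> CC R) :=
  [set g | exists2 n, (0 < n)%N & g = iter n f].

Definition fatou_set (R : realType) (f : CC R -> CC R) : set (CC R) :=
  [set z | exists2 U, open_nbhs z U & normal_family U (iterates f)].

Definition julia_set (R : realType) (f : CC R -> CC R) : set (CC R) :=
  ~` fatou_set f.

(* For continuous f the supremum is attained, hence is a maximum. *)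
Definition max_modulus (R : realType) (f : CC R -> CC R) (r : R) : R :=
  sup [set modulus (f z) | z in [set z | modulus z = r]].

Definition fast_escaping_AR (R : realType) (f : CC R -> CC R) (rho : R) :
    set (CC R) :=
  [set z | forall n, (0 < n)%N ->
    iter n (max_modulus f) rho <= modulus (iter n f z)].

Definition boundary (T : topologicalType) (A : set T) : set T :=
  closure A `\` interior A.

Definition domain (R : realType) (G : set (CC R)) : Prop :=
  [/\ open G, G !=set0 & connected G].

(* Every loop in G contracts in G to its base point, through loops with that
   base point. Path-connectedness is not included: for a domain it follows
   from openness and connectedness. *)
Definition loops_contract (R : realType) (G : set (CC R)) : Prop :=
  forall gamma : R -> CC R,
    {within `[0, 1], continuous gamma} ->
    (forall t : R, 0 <= t <= 1 -> G (gamma t)) ->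
    gamma 0 = gamma 1 ->
    exists H : R * R -> CC R,
      [/\ {within `[0, 1] `*` `[0, 1], continuous H},
          forall s t : R, 0 <= s <= 1 -> 0 <= t <= 1 -> G (H (s, t)),
          forall t : R, 0 <= t <= 1 -> H (0, t) = gamma t,
          forall t : R, 0 <= t <= 1 -> H (1, t) = gamma 0 &
          forall s : R, 0 <= s <= 1 -> H (s, 0) = gamma 0 /\ H (s, 1) = gamma 0].

Definition simply_connected_domain (R : realType) (G : set (CC R)) : Prop :=
  domain G /\ loops_contract G.

Definition spiders_web (R : realType) (E : set (CC R)) : Prop :=
  connected E /\
  exists G : nat -> set (CC R),
    [/\ forall n, simply_connected_domain (G n) /\ bounded_set (G n),
        forall n, boundary (G n) `<=` E,
        forall n, G n `<=` G n.+1 &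
        \bigcup_n G n = [set: CC R]].

(* [connected_component B x] is empty when x is not in B; here f nonconstant and
   0 < rho give modulus (f 0) < max_modulus f rho, so 0 is in the complement. *)
Definition fundamental_hole (R : realType) (f : CC R -> CC R) (rho : R) :
    set (CC R) :=
  connected_component (~` fast_escaping_AR f rho) 0.

Definition is_fundamental_loop (R : realType) (f : CC R -> CC R)
    (L : set (CC R)) : Prop :=
  exists rho : R,
    [/\ 0 < rho,
        iter n (max_modulus f) rho @[n --> \oo] --> +oo,
        spiders_web (fast_escaping_AR f rho) &
        L = boundary (fundamental_hole f rho)].

(* Main.v *)
Require Import Defs.
From mathcomp Require Import all_boot all_order all_algebra.
From mathcomp Require Import complex ring lra.
From mathcomp Require Import all_classical all_reals all_analysis.

Set Implicit Arguments.
Unset Strict Implicit.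
Unset Printing Implicit Defensive.

Import Order.TTheory GRing.Theory Num.Theory.
Import numFieldNormedType.Exports.

Local Open Scope classical_set_scope.
Local Open Scope ring_scope.
Local Open Scope complex_scope.

Local Notation Re := complex.Re.
Local Notation Im := complex.Im.

(* Write r_n = M^n(R) and t_n = log r_n.  By Hadamard's three circles theorem log M is a convex
   function of log r, and log M(r) >= 2 log r - O(1) as f is not a polynomial.  Hence if
   |f^k(w)| < r_k for some k, that is if w is not in A_R, then the relative gap
   1 - log|f^n(w)| / t_n stays bounded away from 0.

   Let z0 in L_R lie in the Fatou set.  Then f^n -> oo uniformly on a disc about z0, on which
   phi_n = (log f^n) / t_n is an equicontinuous family of maps into the right half-plane, by
   Harnack's inequality.  Since Re phi_n(z0) >= 1 while Re phi_n(w) <= 1 - eps at a point w of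
   the hole near z0, the phi_n stay away from the constants, so phi_n(disc) contains a disc of
   fixed radius about phi_n(z0), and f^n(disc) contains an annulus
   r_n^(1 - eta) <= |z| <= r_n^(1 + 3 eta).  Points of the disc where |f^n| = r_n^(1 + 2 eta)
   belong to A_R, so f^n maps the hole H_R, which avoids A_R, inside that circle.  Thus f^n(L_R)
   lies in the annulus r_n <= |z| <= r_n^(1 + 2 eta), which is covered by f^n(disc), and the
   iterates tend to infinity locally uniformly near L_R.

   All the complex analysis rests on the maximum principle, itself a consequence of Goursat's
   lemma for trapezoidal sums. *)

(** Why a gap [1 - eps] that is uniform in n: knowing only |f^n(w)| < r_n, the phi_n could approach
    a constant and the disc inside phi_n(disc) could shrink. In the plane of log f^n that disc has
    radius a constant times t_n, which in the end exceeds 2 pi, so exp wraps it around a full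
    annulus. Why a point y of the disc with |f^n(y)| = r_n^(1 + 2 eta) is in A_R: off A_R the
    inequality Re phi_n < 1 holds from some n on, and equicontinuity turns this into Re phi_n < 1 +
    2 eta on the whole disc minus A_R, for all large n at once. Why the hole cannot cross that
    circle: it is connected and contains a point with |f^n| < r_n, so crossing gives v in the hole
    with f^n(v) = f^n(y), y in A_R as above. Since M strictly dominates f inside a circle, one
    failure of |f^k| >= r_k persists for all larger k; membership in A_R is thus a property of the
    tail of the orbit, and v would lie in A_R. The exponents 1 - eta and 1 + 3 eta leave a margin on
    both sides of the annulus r_n <= |z| <= r_n^(1 + 2 eta), so that neighbourhoods of points of the
    loop are covered too. *)

(** * Real-valued modulus, continuity and compactness in the plane *)

Section Modulus.
Context (R : realType).
Implicit Types z w : CC R.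

Lemma mod_ge0 z : 0 <= modulus z.
Proof. by case: z => a b; exact: sqrtr_ge0. Qed.

Lemma modM z w : modulus (z * w) = modulus z * modulus w.
Proof. exact: ComplexField.Normc.normcM. Qed.

Lemma modV z : modulus z^-1 = (modulus z)^-1.
Proof. exact: ComplexField.Normc.normcV. Qed.

Lemma normCC z : `|z| = (modulus z)%:C.
Proof. by case: z. Qed.

Lemma modD z w : modulus (z + w) <= modulus z + modulus w.
Proof. by have := ler_normD z w; rewrite !normCC -rmorphD lecR. Qed.

Lemma mod0 : modulus (0 : CC R) = 0.
Proof. exact: ComplexField.Normc.normc0. Qed.

Lemma mod1 : modulus (1 : CC R) = 1.
Proof. exact: ComplexField.Normc.normc1. Qed.

Lemma mod_eq0 z : (modulus z == 0) = (z == 0).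
Proof.
apply/eqP/eqP => [/ComplexField.Normc.eq0_normc //|->]; exact: mod0.
Qed.

Lemma mod_gt0 z : (0 < modulus z) = (z != 0).
Proof. by rewrite lt_def mod_ge0 mod_eq0 andbT. Qed.

Lemma modN z : modulus (- z) = modulus z.
Proof. by apply: complexI; rewrite -!normCC normrN. Qed.

Lemma modBC z w : modulus (z - w) = modulus (w - z).
Proof. by rewrite -modN opprB. Qed.

Lemma modX z n : modulus (z ^+ n) = modulus z ^+ n.
Proof. by elim: n => [|n IH]; rewrite ?expr0 ?mod1 // !exprS modM IH. Qed.

Lemma modR (x : R) : modulus (x%:C : CC R) = `|x|.
Proof. by rewrite /modulus /= expr0n addr0 sqrtr_sqr. Qed.

Lemma mod_triangle z w u : modulus (z - w) <= modulus (z - u) + modulus (u - w).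
Proof. by rewrite -[z - w](subrKA u) modD. Qed.

Lemma modB_ge z w : modulus z - modulus w <= modulus (z - w).
Proof. by rewrite lerBlDr -{1}(subrK w z) modD. Qed.

Lemma mod_dist z w : `|modulus z - modulus w| <= modulus (z - w).
Proof.
by rewrite ler_norml modB_ge andbT lerNl opprB modBC modB_ge.
Qed.

Lemma Re_le_mod z : `|Re z| <= modulus z.
Proof.
case: z => a b; rewrite /= -sqrtr_sqr ler_wsqrtr // lerDl sqr_ge0 //.
Qed.

Lemma Im_le_mod z : `|Im z| <= modulus z.
Proof.
case: z => a b; rewrite /= -sqrtr_sqr ler_wsqrtr // lerDr sqr_ge0 //.
Qed.

Lemma mod_le_ReIm z : modulus z <= `|Re z| + `|Im z|.
Proof.
have -> : z = (Re z)%:C + 'i%C * (Im z)%:C by exact: complexE.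
apply: le_trans (modD _ _) _; rewrite modM !modR.
have -> : modulus ('i%C : CC R) = 1.
  by rewrite /modulus /= expr0n add0r expr1n sqrtr1.
by rewrite mul1r; case: z => a b /=; rewrite !(mul0r,mulr0,addr0,add0r,mul1r,subr0).
Qed.

Lemma mod_sqr z : modulus z ^+ 2 = Re z ^+ 2 + Im z ^+ 2.
Proof. by case: z => a b; rewrite /= sqr_sqrtr // addr_ge0 ?sqr_ge0. Qed.

Lemma cReD z w : Re (z + w) = Re z + Re w. Proof. by case: z w => [a b] [c d]. Qed.
Lemma cImD z w : Im (z + w) = Im z + Im w. Proof. by case: z w => [a b] [c d]. Qed.
Lemma cReN z : Re (- z) = - Re z. Proof. by case: z => [a b]. Qed.
Lemma cImN z : Im (- z) = - Im z. Proof. by case: z => [a b]. Qed.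
Lemma cReM z w : Re (z * w) = Re z * Re w - Im z * Im w.
Proof. by case: z w => [a b] [c d]. Qed.
Lemma cImM z w : Im (z * w) = Re z * Im w + Im z * Re w.
Proof. by case: z w => [a b] [c d]. Qed.

Lemma CC_eq z w : Re z = Re w -> Im z = Im w -> z = w.
Proof. by case: z w => [a b] [c d] /= -> ->. Qed.

(** The norm of [CC R] takes values in [CC R], which is only partially ordered. With real radii here
    and in the continuity criteria below, all estimates take place in [R]. *)
Lemma nbhs_modP z (V : set (CC R)) :
  nbhs z V <-> exists2 d : R, 0 < d & forall w, modulus (w - z) < d -> V w.
Proof.
split.
  move=> /nbhs_ballP[e /= e0 eV]; exists (Re e).
    by move: e0; rewrite ltcE /= => /andP[].
  move=> w zw; apply: eV; rewrite /ball /= distrC normCC ltcE /=.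
  by move: e0; rewrite ltcE /= => /andP[/eqP ->]; rewrite eqxx.
move=> [d d0 dV]; apply/nbhs_ballP; exists (d%:C : CC R); first by rewrite /= ltcR.
by move=> w; rewrite /ball /= distrC normCC ltcR; exact: dV.
Qed.

Lemma contP (g : CC R -> CC R) z : {for z, continuous g} <->
  forall e : R, 0 < e -> exists2 d : R, 0 < d &
    forall w, modulus (w - z) < d -> modulus (g w - g z) < e.
Proof.
split=> [gz e e0|gz V /nbhs_modP[e /gz[d d0 dV] eV]].
  have /gz/nbhs_modP[d d0 dV] : nbhs (g z) [set y | modulus (y - g z) < e].
    by apply/nbhs_modP; exists e.
  by exists d.
by apply/nbhs_modP; exists d => // w /dV /eV.
Qed.

Lemma contRP (v : CC R -> R) z : {for z, continuous v} <->
  forall e : R, 0 < e -> exists2 d : R, 0 < d &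
    forall w, modulus (w - z) < d -> `|v w - v z| < e.
Proof.
split=> [gz e e0|gz V /nbhs_ballP[e /gz[d d0 dV] eV]].
  have /gz/nbhs_modP[d d0 dV] : nbhs (v z) [set y | `|y - v z| < e].
    by apply/nbhs_ballP; exists e => // y; rewrite /ball /= distrC.
  by exists d.
by apply/nbhs_modP; exists d => // w /dV zw; apply: eV; rewrite /ball /= distrC.
Qed.

Lemma contCP (g : R -> CC R) x : {for x, continuous g} <->
  forall e : R, 0 < e -> exists2 d : R, 0 < d &
    forall y, `|y - x| < d -> modulus (g y - g x) < e.
Proof.
split=> [gz e e0|gz V /nbhs_modP[e /gz[d d0 dV] eV]].
  have /gz/nbhs_ballP[d d0 dV] : nbhs (g x) [set y | modulus (y - g x) < e].
    by apply/nbhs_modP; exists e.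
  by exists d => // y xy; apply: dV; rewrite /ball /= distrC.
by apply/nbhs_ballP; exists d => // y; rewrite /ball /= distrC => /dV /eV.
Qed.

Lemma continuous_modulus : continuous (@modulus R).
Proof.
move=> z; apply/contRP => e e0; exists e => // w; exact/le_lt_trans/mod_dist.
Qed.

Lemma continuous_Re : continuous (@Re R : CC R -> R).
Proof.
move=> z; apply/contRP => e e0; exists e => // w; apply/le_lt_trans.
by rewrite -cReN -cReD Re_le_mod.
Qed.

Lemma continuous_Im : continuous (@Im R : CC R -> R).
Proof.
move=> z; apply/contRP => e e0; exists e => // w; apply/le_lt_trans.
by rewrite -cImN -cImD Im_le_mod.
Qed.

Lemma continuous_ofR : continuous (fun x : R => x%:C : CC R).
Proof. by move=> x; apply/contCP => e e0; exists e => // y; rewrite -rmorphB modR. Qed.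

Lemma compact_box (r : R) : compact [set z : CC R | `|Re z| <= r /\ `|Im z| <= r].
Proof.
pose F (p : R * R) : CC R := p.1%:C + 'i%C * p.2%:C.
have -> : [set z : CC R | `|Re z| <= r /\ `|Im z| <= r] =
    F @` (`[- r, r] `*` `[- r, r]).
  apply/seteqP; split => [z /= [zr zi]|_ [[x y] /= [xr yr] <-]].
    exists (Re z, Im z); last by rewrite /F -complexE.
    by split; rewrite /= in_itv /= -ler_norml.
  move: xr yr; rewrite !in_itv /= -!ler_norml.
  by rewrite /F /= !(mul0r,mulr0,addr0,add0r,mul1r,subr0).
apply: continuous_compact; last first.
  by apply: compact_setX; exact: segment_compact.
apply: continuous_subspaceT => p.
apply: cvgD; first by apply: (cvg_comp _ _ cvg_fst); exact: continuous_ofR.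
apply: cvgMr; by apply: (cvg_comp _ _ cvg_snd); exact: continuous_ofR.
Qed.

Lemma compact_closed_bounded (K : set (CC R)) (r : R) :
  closed K -> (forall z, K z -> modulus z <= r) -> compact K.
Proof.
move=> cK bK; apply: (subclosed_compact cK (@compact_box r)) => z /bK zr.
by split; apply: le_trans zr; [exact: Re_le_mod | exact: Im_le_mod].
Qed.

Lemma closed_le_fun (v : CC R -> R) (r : R) :
  continuous v -> closed [set z | v z <= r].
Proof.
move=> cv; apply: (@closed_comp _ _ v [set x : R | x <= r]) (@closed_le R r).
by move=> z _; exact: cv.
Qed.

Lemma closed_ge_fun (v : CC R -> R) (r : R) :
  continuous v -> closed [set z | r <= v z].
Proof.
move=> cv; apply: (@closed_comp _ _ v [set x : R | r <= x]) (@closed_ge R r).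
by move=> z _; exact: cv.
Qed.

Lemma continuous_mod_sub (a : CC R) : continuous (fun z => modulus (z - a)).
Proof.
move=> z; apply/contRP => e e0; exists e => // w zw.
by apply: le_lt_trans (mod_dist _ _) _; rewrite opprB addrA subrK.
Qed.

Lemma closed_mod_le (a : CC R) (r : R) : closed [set z : CC R | modulus (z - a) <= r].
Proof. exact/closed_le_fun/continuous_mod_sub. Qed.

Lemma compact_disc (a : CC R) (r : R) : compact [set z : CC R | modulus (z - a) <= r].
Proof.
apply: (@compact_closed_bounded _ (r + modulus a)); first exact: closed_mod_le.
move=> z /= zr; rewrite -(subrK a z); apply: le_trans (modD _ _) _.
by rewrite lerD2r.
Qed.

End Modulus.

(* Caratheodory's form of complex differentiability: the difference quotient extends continuously. *)
Definition hol (R : realType) (g : CC R -> CC R) (z : CC R) : Prop :=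
  exists2 q : CC R -> CC R, {for z, continuous q} &
    forall w, g w - g z = q w * (w - z).

(** * Calculus of holomorphic functions *)

Section Holomorphic.
Context (R : realType).
Implicit Types (z w : CC R) (g h : CC R -> CC R).

(** [hol] asks for a quotient valid on the whole plane but continuous at [z] only, so off the disc
    the plain difference quotient can be used. *)
Lemma hol_local g (q : CC R -> CC R) z (d : R) : 0 < d -> {for z, continuous q} ->
  (forall w, modulus (w - z) < d -> g w - g z = q w * (w - z)) -> hol g z.
Proof.
move=> d0 cq gq.
exists (fun w => if modulus (w - z) < d then q w else (g w - g z) / (w - z)).
  move/contP : cq => cq; apply/contP => e /cq[d' d'0 qd'].
  exists (Num.min d d'); first by rewrite lt_min d0.
  by move=> w; rewrite lt_min => /andP[wd wd']; rewrite subrr mod0 d0 wd qd'.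
move=> w; case: ifPn => [/gq //|]; rewrite -leNgt => dw.
by rewrite divfK // -mod_gt0 (lt_le_trans d0).
Qed.

Lemma hol_near g h z (d : R) : 0 < d ->
  (forall w, modulus (w - z) < d -> g w = h w) -> hol g z -> hol h z.
Proof.
move=> d0 gh [q cq gq]; apply: (hol_local d0 cq) => w wz.
by rewrite -!gh // subrr mod0.
Qed.

Lemma cont_cst (c : CC R) z : {for z, continuous (fun=> c : CC R)}.
Proof. exact: (@cst_continuous _ _ c z). Qed.

Lemma cont_id z : {for z, continuous (id : CC R -> CC R)}.
Proof. by move=> V. Qed.

Lemma cont_add g h z : {for z, continuous g} -> {for z, continuous h} ->
  {for z, continuous (fun w => g w + h w)}.
Proof. by move=> cg ch; exact: (cvgD cg ch). Qed.

Lemma cont_opp g z : {for z, continuous g} -> {for z, continuous (fun w => - g w)}.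
Proof. by move=> cg; exact: (cvgN cg). Qed.

Lemma cont_sub g h z : {for z, continuous g} -> {for z, continuous h} ->
  {for z, continuous (fun w => g w - h w)}.
Proof. by move=> cg ch; exact: (cvgB cg ch). Qed.

Lemma cont_mul g h z : {for z, continuous g} -> {for z, continuous h} ->
  {for z, continuous (fun w => g w * h w)}.
Proof. by move=> cg ch; exact: (cvgM cg ch). Qed.

Lemma cont_inv g z : g z != 0 -> {for z, continuous g} ->
  {for z, continuous (fun w => (g w)^-1)}.
Proof. by move=> gz0 cg; exact: (cvgV gz0 cg). Qed.

Lemma cont_ext g h z : (forall w, g w = h w) -> {for z, continuous g} ->
  {for z, continuous h}.
Proof. by move=> /funext ->. Qed.

Lemma cont_comp g h z : {for h z, continuous g} -> {for z, continuous h} ->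
  {for z, continuous (fun w => g (h w))}.
Proof.
move=> /contP cg /contP ch; apply/contP => e /cg[d /ch[d' d'0 hd] gd].
by exists d' => // w /hd /gd.
Qed.

Lemma hol_cont g z : hol g z -> {for z, continuous g}.
Proof.
move=> [q cq gq].
have := cont_add (@cont_cst (g z) z) (cont_mul cq (cont_sub (@cont_id z) (@cont_cst z z))).
by apply: cont_ext => w /=; rewrite -gq addrC subrK.
Qed.

Lemma hol_cst (c : CC R) z : hol (fun=> c) z.
Proof.
by exists (fun=> 0) => [|w]; [exact: cont_cst | rewrite subrr mul0r].
Qed.

Lemma hol_id z : hol id z.
Proof. by exists (fun=> 1) => [|w]; [exact: cont_cst | rewrite mul1r]. Qed.

Lemma hol_add g h z : hol g z -> hol h z -> hol (fun w => g w + h w) z.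
Proof.
move=> [p cp gp] [q cq gq]; exists (fun w => p w + q w) => [|w].
  exact: cont_add.
by rewrite mulrDl -gp -gq; ring.
Qed.

Lemma hol_mul g h z : hol g z -> hol h z -> hol (fun w => g w * h w) z.
Proof.
move=> hg [q cq gq]; have cg := hol_cont hg; case: hg => p cp gp.
exists (fun w => g w * q w + p w * h z) => [|w].
  exact: cont_add (cont_mul cg cq) (cont_mul cp (@cont_cst _ _)).
by rewrite mulrDl -mulrA -gq mulrAC -gp; ring.
Qed.

Lemma hol_opp g z : hol g z -> hol (fun w => - g w) z.
Proof.
move=> hg; have := hol_mul (hol_cst (-1) z) hg.
by congr hol; apply/funext => w; rewrite mulN1r.
Qed.

Lemma hol_sub g h z : hol g z -> hol h z -> hol (fun w => g w - h w) z.
Proof. by move=> hg hh; apply: hol_add hg (hol_opp hh). Qed.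

Lemma hol_inv g z : g z != 0 -> hol g z -> hol (fun w => (g w)^-1) z.
Proof.
move=> gz0 hg; have cg := hol_cont hg; case: hg => p cp gp.
have [d d0 dP] : exists2 d : R, 0 < d & forall w, modulus (w - z) < d -> g w != 0.
  move/contP : cg => /(_ (modulus (g z))); rewrite mod_gt0 => /(_ gz0) [d d0 dP].
  exists d => // w /dP; apply: contraTneq => ->.
  by rewrite sub0r modN ltxx.
apply: (@hol_local _ (fun w => - p w / (g w * g z)) z d d0) => [|w /dP gw0].
  apply: cont_mul (cont_opp cp) (cont_inv _ (cont_mul cg (@cont_cst _ _))).
  by rewrite mulf_neq0.
rewrite mulrAC mulNr -gp; field; exact/andP.
Qed.

Lemma hol_div g h z : h z != 0 -> hol g z -> hol h z -> hol (fun w => g w / h w) z.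
Proof. by move=> hz hg hh; apply: hol_mul hg _; exact: hol_inv. Qed.

Lemma hol_comp g h z : hol g (h z) -> hol h z -> hol (fun w => g (h w)) z.
Proof.
move=> [p cp gp] hh; have ch := hol_cont hh; case: hh => q cq hq.
exists (fun w => p (h w) * q w) => [|w]; last by rewrite gp hq mulrA.
exact: cont_mul (cont_comp cp ch) cq.
Qed.

Lemma hol_exp g z n : hol g z -> hol (fun w => g w ^+ n) z.
Proof.
move=> hg; elim: n => [|n IH].
  by have := hol_cst 1 z; congr hol; apply/funext => w; rewrite expr0.
have := hol_mul hg IH; congr hol; apply/funext => w; by rewrite exprS.
Qed.

Lemma derivable_hol g z : derivable g z 1 -> hol g z.
Proof.
move=> /cvg_ex[l /= gl].
have {}gl (e : R) : 0 < e -> exists2 d : R, 0 < d & forall w, w != z ->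
    modulus (w - z) < d -> modulus ((g w - g z) / (w - z) - l) < e.
  move=> e0.
  have /gl/nbhs_modP[d d0 dP] : nbhs (l : CC R) [set y : CC R | modulus (y - l) < e].
    by apply/nbhs_modP; exists e.
  exists d => // w wz wd; have := dP (w - z); rewrite subr0 => /(_ wd).
  rewrite subr_eq0 => /(_ wz) /=.
  by rewrite [_%:A]mulr1 subrK [_ *: _]mulrC.
exists (fun w => if w == z then l else (g w - g z) / (w - z)); last first.
  move=> w; case: eqVneq => [->|wz]; first by rewrite !subrr mulr0.
  by rewrite divfK // subr_eq0.
apply/contP => e e0; have [d d0 dP] := gl _ e0; exists d => // w wd.
rewrite eqxx; case: eqVneq => [_|wz]; first by rewrite subrr mod0.
exact: dP.
Qed.

(** Continuity at [a] and holomorphy elsewhere are what the maximum principle below asks of a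
    function, so it applies directly to such quotients. *)
Lemma hol_quotient g a : hol g a -> exists q : CC R -> CC R,
  [/\ {for a, continuous q}, forall w, g w - g a = q w * (w - a),
      forall w, w != a -> {for w, continuous g} -> {for w, continuous q} &
      forall w, w != a -> hol g w -> hol q w].
Proof.
move=> [q cq gq]; exists q.
have qE w : w != a -> forall u, modulus (u - w) < modulus (w - a) ->
    (g u - g a) / (u - a) = q u.
  move=> wa u uw; rewrite gq mulfK // subr_eq0; apply: contraTneq uw => ->.
  by rewrite modBC ltxx.
split; [exact: cq | exact: gq | move=> w wa hg | move=> w wa hg];
  have wa' : w - a != 0 by rewrite subr_eq0.
- have : {for w, continuous (fun u => (g u - g a) / (u - a))}.
    have c1 := cont_sub hg (@cont_cst (g a) w).
    have c2 := cont_sub (@cont_id w) (@cont_cst a w).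
    exact: (cont_mul c1 (@cont_inv (fun u => u - a) w wa' c2)).
  move=> /contP cw; apply/contP => e /cw[d d0 dP].
  have m0 : 0 < modulus (w - a) by rewrite mod_gt0.
  exists (Num.min d (modulus (w - a))) => [|u]; first by rewrite lt_min d0.
  rewrite lt_min => /andP[/dP ud /(qE w wa) <-].
  by rewrite -(qE w wa w) ?subrr ?mod0.
apply: (@hol_near (fun u => (g u - g a) / (u - a)) _ _ (modulus (w - a))).
- by rewrite mod_gt0.
- exact: qE.
- apply: hol_div => //; first exact: hol_sub hg (hol_cst _ _).
  exact: hol_sub (hol_id _) (hol_cst _ _).
Qed.

End Holomorphic.

(** * The complex exponential and its logarithms *)

Definition cexp (R : realType) (z : CC R) : CC R :=
  ((expR (Re z))%:C : CC R) * (cos (Im z) +i* sin (Im z)).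

(* This is a logarithm on the right half-plane only. *)
Definition clog (R : realType) (z : CC R) : CC R :=
  ln (modulus z) +i* asin (Im z / modulus z).

Section ComplexExponential.
Context (R : realType).
Implicit Types (z w : CC R).

Lemma Re_cexp z : Re (cexp z) = expR (Re z) * cos (Im z).
Proof. by rewrite cReM /= mul0r subr0. Qed.

Lemma Im_cexp z : Im (cexp z) = expR (Re z) * sin (Im z).
Proof. by rewrite cImM /= mul0r addr0. Qed.

Lemma cexpD z w : cexp (z + w) = cexp z * cexp w.
Proof.
apply: CC_eq; rewrite ?(cReM, cImM, Re_cexp, Im_cexp, cReD, cImD, expRD, cosD, sinD);
  ring.
Qed.

Lemma cexp0 : cexp 0 = 1 :> CC R.
Proof. by apply: CC_eq; rewrite ?Re_cexp ?Im_cexp /= expR0 ?cos0 ?sin0 ?mulr1 ?mulr0. Qed.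

Lemma mod_cexp z : modulus (cexp z) = expR (Re z).
Proof.
rewrite modM modR ger0_norm ?expR_ge0 // /modulus /= cos2Dsin2 sqrtr1 mulr1 //.
Qed.

Lemma cexp_neq0 z : cexp z != 0.
Proof. by rewrite -mod_gt0 mod_cexp expR_gt0. Qed.

Lemma cexpN z : cexp (- z) = (cexp z)^-1.
Proof.
apply: (mulfI (cexp_neq0 z)).
by rewrite -cexpD subrr cexp0 divff // cexp_neq0.
Qed.

Lemma cexpB z w : cexp (z - w) = cexp z / cexp w.
Proof. by rewrite cexpD cexpN. Qed.

Lemma is_derive_linear_approx (f : R -> R) (x l : R) : is_derive x 1 f l ->
  forall e : R, 0 < e -> exists2 d : R, 0 < d &
    forall h, `|h| < d -> `|f (x + h) - f x - l * h| <= e * `|h|.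
Proof.
move=> [/cvg_ex[l' /= fl'] fl] e e0.
have {fl} ll' : l' = l by rewrite -fl; apply/esym/cvg_lim.
subst l'.
have /fl'/nbhs_ballP[d /= d0 dP] : nbhs l [set y | `|y - l| < e].
  by apply/nbhs_ballP; exists e => //= y; rewrite /ball /= distrC.
exists d => // h hd; have [->|h0] := eqVneq h 0.
  by rewrite addr0 subrr mulr0 subr0 normr0 mulr0.
have := dP h; rewrite /ball /= sub0r normrN => /(_ hd h0).
rewrite /= [_%:A]mulr1 => H; rewrite [x + h]addrC.
have -> : f (h + x) - f x - l * h = (h^-1 *: (f (h + x) - f x) - l) * h.
  by rewrite /GRing.scale /=; field.
by rewrite normrM ler_wpM2r // ltW.
Qed.

Lemma cexp_approx0 (e : R) : 0 < e -> exists2 d : R, 0 < d &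
  forall w, modulus w < d -> modulus (cexp w - 1 - w) <= e * modulus w.
Proof.
move=> e0.
(* The bound 1 gives [expR x <= 2]; the real part of the error then costs [1 + 2] and the imaginary
   part [2 + 1] times [e' * modulus w]. *)
pose e' : R := Num.min 1 (e / 6).
have e'0 : 0 < e' by rewrite lt_min ltr01 divr_gt0.
have e'1 : e' <= 1 by rewrite ge_min lexx.
have e'e : 6 * e' <= e.
  by rewrite -[leRHS](@divfK _ 6) // [leRHS]mulrC ler_pM2l // ge_min lexx orbT.
have [d1 d10 H1] := is_derive_linear_approx (is_derive_expR (0 : R)) e'0.
have [d2 d20 H2] := is_derive_linear_approx (is_derive_cos (0 : R)) e'0.
have [d3 d30 H3] := is_derive_linear_approx (is_derive_sin (0 : R)) e'0.
have [d4 d40 H4] : exists2 d : R, 0 < d & forall x, `|x| < d -> `|expR x - 1| < e'.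
  have /(@continuous_expR R)/nbhs_ballP[d /= d0 dP] :
      nbhs (expR (0:R)) [set y | `|y - expR (0:R)| < e'].
    by apply/nbhs_ballP; exists e' => //= y; rewrite /ball /= distrC.
  by exists d => // x xd; have := dP x; rewrite /ball /= sub0r normrN expR0; exact.
exists (Num.min (Num.min d1 d2) (Num.min d3 d4)); first by rewrite !lt_min d10 d20 d30.
move=> w; rewrite !lt_min => /andP[/andP[w1 w2] /andP[w3 w4]].
set x := Re w; set y := Im w.
have xw : `|x| <= modulus w by exact: Re_le_mod.
have yw : `|y| <= modulus w by exact: Im_le_mod.
have {H1} := H1 x (le_lt_trans xw w1).
have {H2} := H2 y (le_lt_trans yw w2).
have {H3} := H3 y (le_lt_trans yw w3).
have {H4} := H4 x (le_lt_trans xw w4).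
rewrite !add0r expR0 cos0 sin0 !(oppr0,mul0r,subr0,mul1r) => H4 H3 H2 H1.
apply: le_trans (mod_le_ReIm _) _.
have -> : Re (cexp w - 1 - w) = (expR x - 1 - x) + expR x * (cos y - 1).
  by rewrite !cReD !cReN Re_cexp /= -/x -/y; ring.
have -> : Im (cexp w - 1 - w) = expR x * (sin y - y) + (expR x - 1) * y.
  by rewrite !cImD !cImN Im_cexp /= -/x -/y; ring.
have E2 : `|expR x| <= 2.
  rewrite ger0_norm ?expR_ge0 // -(subrK 1 (expR x)).
  have := ler_norm (expR x - 1); lra.
have K1 : `|expR x * (cos y - 1)| <= 2 * (e' * `|y|).
  by rewrite normrM ler_pM.
have K2 : `|expR x * (sin y - y)| <= 2 * (e' * `|y|).
  by rewrite normrM ler_pM.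
have K3 : `|(expR x - 1) * y| <= e' * `|y|.
  by rewrite normrM ler_wpM2r // ltW.
have := ler_normD (expR x - 1 - x) (expR x * (cos y - 1)).
have := ler_normD (expR x * (sin y - y)) ((expR x - 1) * y).
have L1 : e' * `|x| <= e' * modulus w by rewrite ler_pM2l.
have L2 : e' * `|y| <= e' * modulus w by rewrite ler_pM2l.
have L3 : 6 * e' * modulus w <= e * modulus w by rewrite ler_wpM2r // mod_ge0.
lra.
Qed.

(** The functional equation carries the difference quotient at 0 to every other point. *)
Lemma hol_cexp z : hol (@cexp R) z.
Proof.
pose p w := if w == 0 then 1 else (cexp w - 1) / w : CC R.
have pE w : cexp w - 1 = p w * w.
  by rewrite /p; case: eqVneq => [->|w0]; rewrite ?cexp0 ?subrr ?mulr0 // divfK.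
have cp : {for 0, continuous p}.
  apply/contP => e e0; have [d d0 dP] := cexp_approx0 (divr_gt0 e0 (ltr0n R 2)).
  exists d => // w; rewrite subr0 => /dP; rewrite /p eqxx.
  case: eqVneq => [->|w0 H]; first by rewrite subrr mod0.
  have -> : (cexp w - 1) / w - 1 = (cexp w - 1 - w) / w by field.
  rewrite modM modV; apply: (@le_lt_trans _ _ (e / 2)); last lra.
  by rewrite ler_pdivrMr // mod_gt0.
exists (fun w => cexp z * p (w - z)) => [|w].
  apply: cont_mul; first exact: cont_cst.
  apply: cont_comp; first by rewrite subrr.
  exact: cont_sub (@cont_id _ _) (@cont_cst _ _ _).
by rewrite -mulrA -pE mulrBr mulr1 -cexpD [z + _]addrC subrK.
Qed.

Lemma cos_sin_surj (a b : R) : a ^+ 2 + b ^+ 2 = 1 ->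
  exists2 t : R, `|t| <= pi & cos t = a /\ sin t = b.
Proof.
move=> ab; have a1 : -1 <= a <= 1.
  have := sqr_ge0 b; rewrite expr2 => ?; apply/andP; split; nra.
have as0 := acos_ge0 a1; have aspi := acos_lepi a1.
have sE : sin (acos a) = `|b|.
  by rewrite sin_acos // -ab addrAC subrr add0r sqrtr_sqr.
have ca : cos (acos a) = a by apply: acosK; rewrite in_itv.
case: (leP 0 b) => b0.
- exists (acos a); first by rewrite ger0_norm.
  by rewrite sE ger0_norm.
- exists (- acos a); first by rewrite normrN ger0_norm.
  by rewrite cosN sinN sE ltr0_norm // opprK.
Qed.

(** Rotating by [- b] before taking the angle makes [b] select the branch. The covering of the
    annulus uses this to find a logarithm close to a given one. *)
Lemma cexp_surj (c : CC R) (b : R) : c != 0 -> exists z,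
  [/\ cexp z = c, Re z = ln (modulus c) & `|Im z - b| <= pi].
Proof.
move=> c0; have mc0 : 0 < modulus c by rewrite mod_gt0.
pose u := c / ((modulus c)%:C : CC R) * cexp (0 -i* b).
have mu : modulus u = 1.
  rewrite modM mod_cexp modM modV modR ger0_norm ?ltW //= expR0 mulr1 divff //.
  by rewrite gt_eqF.
have := mod_sqr u; rewrite mu expr1n => /esym/cos_sin_surj[t tpi [ct st]].
have uE : u = cexp (0 +i* t).
  by apply: CC_eq; rewrite ?Re_cexp ?Im_cexp /= expR0 mul1r.
exists (ln (modulus c) +i* (t + b)); split => //=; last by rewrite addrK.
have -> : ln (modulus c) +i* (t + b) =
    (ln (modulus c) +i* 0 : CC R) + (0 +i* t) - (0 -i* b).
  by apply: CC_eq; rewrite !(cReD, cReN, cImD, cImN) /=; ring.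
rewrite cexpB cexpD -uE.
have -> : cexp (ln (modulus c) +i* 0) = (modulus c)%:C :> CC R.
  apply: CC_eq; rewrite ?Re_cexp ?Im_cexp /= lnK ?posrE // ?cos0 ?mulr1 //.
  by rewrite sin0 mulr0.
rewrite /u; field; rewrite cexp_neq0 //=.
by rewrite -mod_eq0 modR normr_eq0 gt_eqF.
Qed.

Lemma cexp_period z : cexp (z + (0 +i* (pi *+ 2))) = cexp z.
Proof.
rewrite cexpD; suff -> : cexp (0 +i* (pi *+ 2)) = 1 :> CC R by rewrite mulr1.
by apply: CC_eq; rewrite ?Re_cexp ?Im_cexp /= expR0 mul1r ?cos2pi ?sin2pi.
Qed.

Lemma Re_gt0_neq0 z : 0 < Re z -> z != 0.
Proof. by apply: contraTneq => ->; rewrite ltxx. Qed.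

Lemma Im_div_mod_lt1 z : 0 < Re z -> -1 < Im z / modulus z < 1.
Proof.
move=> z0; have m0 : 0 < modulus z by rewrite mod_gt0 Re_gt0_neq0.
have := mod_sqr z; have : 0 < Re z ^+ 2 by rewrite exprn_gt0.
rewrite ltr_pdivlMr // ltr_pdivrMr // !expr2 => ? ?.
apply/andP; split; nra.
Qed.

Lemma clogK z : 0 < Re z -> cexp (clog z) = z.
Proof.
move=> z0; have m0 : 0 < modulus z by rewrite mod_gt0 Re_gt0_neq0.
have /andP[y1 y2] := Im_div_mod_lt1 z0.
have y12 : -1 <= Im z / modulus z <= 1 by rewrite !ltW.
have e : expR (Re (clog z)) = modulus z by rewrite /= lnK ?posrE.
apply: CC_eq; rewrite ?Re_cexp ?Im_cexp e /=.
  rewrite cos_asin //.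
  have -> : 1 - (Im z / modulus z) ^+ 2 = (Re z / modulus z) ^+ 2.
    rewrite !expr_div_n (_ : Re z ^+ 2 = modulus z ^+ 2 - Im z ^+ 2).
      by field; rewrite gt_eqF.
    by rewrite mod_sqr addrK.
  by rewrite sqrtr_sqr ger0_norm ?divr_ge0 ?ltW // mulrC divfK // gt_eqF.
by rewrite asinK ?in_itv //= mulrC divfK // gt_eqF.
Qed.

Lemma cont_clog z : 0 < Re z -> {for z, continuous (@clog R)}.
Proof.
move=> z0; have m0 : 0 < modulus z by rewrite mod_gt0 Re_gt0_neq0.
have c1 : {for z, continuous (fun w => ln (modulus w))}.
  by move=> V /(@continuous_ln R _ m0)/(@continuous_modulus R).
have c2 : {for z, continuous (fun w => Im w / modulus w)}.
  apply: (cvgM (@continuous_Im R z)).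
  by apply: (cvgV _ (@continuous_modulus R z)); rewrite gt_eqF.
have c3 : {for z, continuous (fun w => asin (Im w / modulus w))}.
  by move=> V /(continuous_asin (Im_div_mod_lt1 z0))/c2.
apply/contP => e e0; have e20 : 0 < e / 2 by lra.
have /contRP/(_ _ e20)[d1 d10 H1] := c1.
have /contRP/(_ _ e20)[d3 d30 H3] := c3.
exists (Num.min d1 d3); first by rewrite lt_min d10.
move=> w; rewrite lt_min => /andP[/H1 K1 /H3 K3].
apply: le_lt_trans (mod_le_ReIm _) _.
rewrite !(cReD,cImD,cReN,cImN) /=; lra.
Qed.

(** The reciprocal of the difference quotient [p] of [cexp] at [clog z] is a difference quotient of
    [clog]. It is continuous because [p (clog z) = 0] would contradict
    [modulus (cexp h - 1) >= modulus h / 2] for small [h]. *)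
Lemma hol_clog z : 0 < Re z -> hol (@clog R) z.
Proof.
move=> z0; have cl := cont_clog z0.
have [p cp pE] := hol_cexp (clog z).
have [d d0 dP] : exists2 d : R, 0 < d & forall w, modulus (w - z) < d -> 0 < Re w.
  have /contRP/(_ _ z0)[d d0 dP] := @continuous_Re R z.
  exists d => // w /dP; rewrite ltr_norml => /andP[]; lra.
have pz : p (clog z) != 0.
  have [d' d'0 approx] := @cexp_approx0 2^-1 ltac:(lra).
  apply/eqP => p0; move/contP : cp => /(_ (modulus (cexp (clog z)) / 2)).
  rewrite mod_cexp => -[|d1 d10 H]; first by rewrite divr_gt0 // expR_gt0.
  pose h : CC R := ((Num.min d' d1) / 2)%:C.
  have m0 : 0 < Num.min d' d1 by rewrite lt_min d'0.
  have mh : modulus h = Num.min d' d1 / 2 by rewrite modR ger0_norm // ltW // divr_gt0.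
  have h0 : 0 < modulus h by rewrite mh divr_gt0.
  have hm : modulus h < Num.min d' d1 by rewrite mh; lra.
  move: (hm); rewrite lt_min => /andP[/approx A hd1].
  have := H (h + clog z); rewrite addrK p0 subr0 => /(_ hd1).
  have := pE (h + clog z); rewrite addrK cexpD => E.
  move/(congr1 (@modulus R)) : E; rewrite modM -{2}[cexp (clog z)]mul1r -mulrBl modM mod_cexp.
  have : modulus h / 2 <= modulus (cexp h - 1).
    have -> : cexp h - 1 = h - - (cexp h - 1 - h) by ring.
    apply: le_trans (modB_ge _ _); rewrite modN; lra.
  have := expR_gt0 (Re (clog z)); nra.
apply: (@hol_local _ _ (fun w => (p (clog w))^-1) z d d0) => [|w /dP w0].
  exact: cont_inv pz (cont_comp cp cl).
have := pE (clog w); rewrite !clogK // => E.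
have [wz|wz] := eqVneq w z; first by rewrite wz !subrr mulr0.
have : p (clog w) != 0.
  by apply: contra_neq wz => p0; apply/eqP; rewrite -subr_eq0 E p0 mul0r.
by move=> p0; rewrite E mulrA mulVf // mul1r.
Qed.

End ComplexExponential.

(* Trapezoidal sum for the integral of [F] over the segment [p, p + h] cut into [2 ^ m] pieces. *)
Fixpoint segment_sum (R : realType) (F : CC R -> CC R) (m : nat) (p h : CC R) : CC R :=
  if m is m'.+1 then segment_sum F m' p (h / 2) + segment_sum F m' (p + h / 2) (h / 2)
  else (F p + F (p + h)) / 2 * h.

Definition contour_sum (R : realType) (F : CC R -> CC R) (m : nat) (a h k : CC R) : CC R :=
  segment_sum F m a h + segment_sum F m (a + h) k
  - segment_sum F m (a + k) h - segment_sum F m a k.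

(** * Goursat's lemma for trapezoidal sums *)

Section Goursat.
Context (R : realType).
Implicit Types (F G : CC R -> CC R) (a p h k w : CC R).

Lemma segment_sumD F G m p h : segment_sum (fun w => F w + G w) m p h =
  segment_sum F m p h + segment_sum G m p h.
Proof. by elim: m p h => [|m IH] p h /=; [field | rewrite !IH; ring]. Qed.

(** Exactness on affine functions is the reason for the trapezoidal rule: the linear part of a
    function contributes exactly 0 to a contour sum, at every level [m]. *)
Lemma segment_sum_affine (b c : CC R) m p h :
  segment_sum (fun w => b + c * w) m p h = b * h + c * (p * h + h ^+ 2 / 2).
Proof. by elim: m p h => [|m IH] p h /=; [|rewrite !IH]; field. Qed.

Lemma segment_sum_cst (b : CC R) m p h : segment_sum (fun=> b) m p h = b * h.
Proof. by elim: m p h => [|m IH] p h /=; [|rewrite !IH]; field. Qed.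

Lemma segment_sum_shift F m u p h :
  segment_sum F m (p + u) h = segment_sum (fun w => F (w + u)) m p h.
Proof.
elim: m p h => [|m IH] p h /=; first by rewrite [p + u + h]addrAC.
by rewrite -!IH [p + u + _]addrAC.
Qed.

Lemma mod_half w : modulus (w / 2) = modulus w / 2.
Proof.
rewrite modM modV; congr (_ / _).
by have := modR (2 : R); rewrite rmorph_nat => ->; rewrite ger0_norm.
Qed.

Lemma segment_sum_le F m p h (s : R) :
  (forall t : R, 0 <= t <= 1 -> modulus (F (p + t%:C * h)) <= s) ->
  modulus (segment_sum F m p h) <= s * modulus h.
Proof.
elim: m p h => [|m IH] p h Fs /=.
  rewrite modM ler_wpM2r ?mod_ge0 // mod_half ler_pdivrMr //.
  apply: le_trans (modD _ _) _; rewrite mulr_natr mulr2n.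
  have := Fs 0; rewrite mul0r addr0 lexx ler01 => /(_ isT).
  have := Fs 1; rewrite mul1r lexx ler01 => /(_ isT); lra.
apply: le_trans (modD _ _) _.
have -> : s * modulus h = s * modulus (h / 2) + s * modulus (h / 2).
  by rewrite mod_half; field.
apply: lerD; apply: IH => t /andP[t0 t1].
- have -> : p + t%:C * (h / 2) = p + (t / 2)%:C * h.
    by rewrite rmorphM fmorphV rmorph_nat; field.
  by apply: Fs; apply/andP; split; lra.
- have -> : p + h / 2 + t%:C * (h / 2) = p + ((t + 1) / 2)%:C * h.
    by rewrite rmorphM rmorphD rmorph1 fmorphV rmorph_nat; field.
  by apply: Fs; apply/andP; split; lra.
Qed.

(** Halving the sides uses up one level, and the inner edges then cancel exactly. The bisection
    therefore works with finite sums. *)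
Lemma contour_sum_quarter F m a h k : contour_sum F m.+1 a h k =
  contour_sum F m a (h / 2) (k / 2) + contour_sum F m (a + h / 2) (h / 2) (k / 2) +
  contour_sum F m (a + k / 2) (h / 2) (k / 2) +
  contour_sum F m (a + h / 2 + k / 2) (h / 2) (k / 2).
Proof.
rewrite /contour_sum /=.
have -> : a + h / 2 + h / 2 = a + h by field.
have -> : a + k / 2 + k / 2 = a + k by field.
have -> : a + h / 2 + k / 2 + h / 2 = a + h + k / 2 by field.
have -> : a + h / 2 + k / 2 + k / 2 = a + k + h / 2 by field.
have -> : a + k / 2 + h / 2 = a + h / 2 + k / 2 by ring.
by ring.
Qed.

Lemma contour_sumD F G m a h k : contour_sum (fun w => F w + G w) m a h k =
  contour_sum F m a h k + contour_sum G m a h k.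
Proof. rewrite /contour_sum !segment_sumD; ring. Qed.

Lemma contour_sum_affine (b c : CC R) m a h k :
  contour_sum (fun w => b + c * w) m a h k = 0.
Proof. by rewrite /contour_sum !segment_sum_affine; field. Qed.

Lemma contour_sum_le F m a h k (s : R) :
  (forall t u : R, 0 <= t <= 1 -> 0 <= u <= 1 ->
    modulus (F (a + t%:C * h + u%:C * k)) <= s) ->
  modulus (contour_sum F m a h k) <= s * (2 * (modulus h + modulus k)).
Proof.
move=> Fs; have i0 : 0 <= (0 : R) <= 1 by rewrite lexx ler01.
have i1 : 0 <= (1 : R) <= 1 by rewrite lexx ler01.
have S1 : modulus (segment_sum F m a h) <= s * modulus h.
  by apply: segment_sum_le => t ti; have := Fs t 0 ti i0; rewrite mul0r addr0.
have S2 : modulus (segment_sum F m (a + h) k) <= s * modulus k.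
  by apply: segment_sum_le => t ti; have := Fs 1 t i1 ti; rewrite mul1r.
have S3 : modulus (segment_sum F m (a + k) h) <= s * modulus h.
  by apply: segment_sum_le => t ti; have := Fs t 1 ti i1; rewrite mul1r addrAC.
have S4 : modulus (segment_sum F m a k) <= s * modulus k.
  by apply: segment_sum_le => t ti; have := Fs 0 t i0 ti; rewrite mul0r addr0.
rewrite /contour_sum.
have T1 := modD (segment_sum F m a h + segment_sum F m (a + h) k
  - segment_sum F m (a + k) h) (- segment_sum F m a k).
have T2 := modD (segment_sum F m a h + segment_sum F m (a + h) k)
  (- segment_sum F m (a + k) h).
have T3 := modD (segment_sum F m a h) (segment_sum F m (a + h) k).
move: T1 T2; rewrite !modN; lra.
Qed.

Definition rect_vertex (x y : R) : CC R := x +i* y.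

(* Goursat's lemma; bisection, with "frequently in [m]" in place of a fixed contour integral. *)
Lemma contour_sum_small F (x y h k : R) : 0 < h -> 0 < k ->
  (forall u v : R, x <= u <= x + h -> y <= v <= y + k -> hol F (rect_vertex u v)) ->
  forall e : R, 0 < e -> exists N, forall m, (N <= m)%N ->
    modulus (contour_sum F m (rect_vertex x y) h%:C (0 +i* k)) <= e.
Proof.
move=> h0 k0 Fhol e e0; apply: contrapT => nsmall.
(* The tolerance is proportional to the area, so that four good quarters make a good rectangle. *)
pose c := e / (h * k); have c0 : 0 < c by rewrite divr_gt0 // mulr_gt0.
pose hn n := h / 2 ^+ n; pose kn n := k / 2 ^+ n.
have hn0 n : 0 < hn n by rewrite divr_gt0 // exprn_gt0.
have kn0 n : 0 < kn n by rewrite divr_gt0 // exprn_gt0.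
have hnS n : hn n = hn n.+1 + hn n.+1 by rewrite /hn exprS; field; rewrite expf_neq0.
have knS n : kn n = kn n.+1 + kn n.+1 by rewrite /kn exprS; field; rewrite expf_neq0.
pose good (p : R * R) n := exists N, forall m, (N <= m)%N ->
  modulus (contour_sum F m (rect_vertex p.1 p.2) (hn n)%:C (0 +i* kn n)) <= c * (hn n * kn n).
have bad0 : ~ good (x, y) 0%N.
  move=> [N HN]; apply: nsmall; exists N => m /HN /=.
  rewrite /hn /kn !expr0 !divr1 /c divfK //.
  by rewrite mulf_neq0 // gt_eqF.
have step (pn : (R * R) * nat) : exists p' : R * R, ~ good pn.1 pn.2 ->
    [/\ ~ good p' pn.2.+1, pn.1.1 <= p'.1, p'.1 <= pn.1.1 + hn pn.2.+1,
        pn.1.2 <= p'.2 & p'.2 <= pn.1.2 + kn pn.2.+1].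
  case: pn => [[u v] n] /=.
  have hS := hn0 n.+1; have kS := kn0 n.+1.
  have [g1|] := pselect (good (u, v) n.+1); last first.
    by exists (u, v) => _; split => //=; lra.
  have [g2|] := pselect (good (u + hn n.+1, v) n.+1); last first.
    by exists (u + hn n.+1, v) => _; split => //=; lra.
  have [g3|] := pselect (good (u, v + kn n.+1) n.+1); last first.
    by exists (u, v + kn n.+1) => _; split => //=; lra.
  have [g4|] := pselect (good (u + hn n.+1, v + kn n.+1) n.+1); last first.
    by exists (u + hn n.+1, v + kn n.+1) => _; split => //=; lra.
  exists (u, v) => ngood; exfalso; apply: ngood.
  case: g1 => N1 /= H1; case: g2 => N2 /= H2; case: g3 => N3 /= H3; case: g4 => N4 /= H4.
  (* One more level than the quarters, since subdividing consumes a level. *)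
  exists (maxn (maxn N1 N2) (maxn N3 N4)).+1 => -[//|m].
  rewrite ltnS !geq_max => /andP[/andP[/H1 B1 /H2 B2] /andP[/H3 B3 /H4 B4]] /=.
  rewrite contour_sum_quarter.
  have -> : ((hn n)%:C / 2 : CC R) = (hn n.+1)%:C.
    by rewrite (hnS n) rmorphD; field.
  have -> : ((0 +i* kn n) / 2 : CC R) = 0 +i* kn n.+1.
    have -> : (0 +i* kn n : CC R) = (0 +i* kn n.+1) + (0 +i* kn n.+1).
      by apply: CC_eq; rewrite ?cReD ?cImD /= ?addr0 // -knS.
    by field.
  have E1 : rect_vertex u v + (hn n.+1)%:C = rect_vertex (u + hn n.+1) v.
    by apply: CC_eq; rewrite ?cReD ?cImD /= ?addr0.
  have E2 u' : rect_vertex u' v + (0 +i* kn n.+1) = rect_vertex u' (v + kn n.+1).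
    by apply: CC_eq; rewrite ?cReD ?cImD /= ?addr0.
  rewrite E1 !E2.
  set b1 := contour_sum _ _ _ _ _ in B1 *; set b2 := contour_sum _ _ _ _ _ in B2 *.
  set b3 := contour_sum _ _ _ _ _ in B3 *; set b4 := contour_sum _ _ _ _ _ in B4 *.
  have T1 := modD (b1 + b2 + b3) b4; have T2 := modD (b1 + b2) b3; have T3 := modD b1 b2.
  have -> : c * (hn n * kn n) = 4 * (c * (hn n.+1 * kn n.+1)).
    by rewrite (hnS n) (knS n); ring.
  lra.
have [next nextP] := choice step.
pose s := fix s n : R * R := if n is n'.+1 then next (s n', n') else (x, y).
have sbad n : ~ good (s n) n.
  by elim: n => //= n /(nextP (s n, n))[].
have sP n : [/\ (s n).1 <= (s n.+1).1, (s n.+1).1 <= (s n).1 + hn n.+1,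
    (s n).2 <= (s n.+1).2 & (s n.+1).2 <= (s n).2 + kn n.+1].
  by have [_ J1 J2 J3 J4] := nextP (s n, n) (sbad n).
have nest n m : [/\ (s n).1 <= (s (n + m)%N).1, (s (n + m)%N).1 + hn (n + m)%N <= (s n).1 + hn n,
    (s n).2 <= (s (n + m)%N).2 & (s (n + m)%N).2 + kn (n + m)%N <= (s n).2 + kn n].
  elim: m => [|m [I1 I2 I3 I4]]; first by rewrite addn0; split.
  have [J1 J2 J3 J4] := sP (n + m)%N; rewrite addnS.
  have := hnS (n + m)%N; have := knS (n + m)%N => E1 E2.
  by split; lra.
pose U := sup [set (s n).1 | n in setT]; pose V := sup [set (s n).2 | n in setT].
have UP n : (s n).1 <= U <= (s n).1 + hn n.
  apply/andP; split.
    apply: ub_le_sup; last by exists n.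
    exists ((s 0%N).1 + hn 0%N) => _ [m _ <-].
    by have [_ + _ _] := nest 0%N m; have := hn0 m; rewrite add0n; lra.
  apply: ge_sup; first by exists (s 0%N).1, 0%N.
  move=> _ [m _ <-]; have [le|/ltnW le] := leqP n m.
    have [_ + _ _] := nest n (m - n)%N; rewrite subnKC //; have := hn0 m; lra.
  have [+ _ _ _] := nest m (n - m)%N; rewrite subnKC //; have := hn0 n; lra.
have VP n : (s n).2 <= V <= (s n).2 + kn n.
  apply/andP; split.
    apply: ub_le_sup; last by exists n.
    exists ((s 0%N).2 + kn 0%N) => _ [m _ <-].
    by have [_ _ _ +] := nest 0%N m; have := kn0 m; rewrite add0n; lra.
  apply: ge_sup; first by exists (s 0%N).2, 0%N.
  move=> _ [m _ <-]; have [le|/ltnW le] := leqP n m.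
    have [_ _ _ +] := nest n (m - n)%N; rewrite subnKC //; have := kn0 m; lra.
  have [_ _ + _] := nest m (n - m)%N; rewrite subnKC //; have := kn0 n; lra.
have [q cq qP] : hol F (rect_vertex U V).
  have := UP 0%N; have := VP 0%N; rewrite /hn /kn expr0 !divr1 /=.
  by move=> VV UU; exact: Fhol.
set z := rect_vertex U V in cq qP.
(* Chosen so that the bound [eps * (hn n + kn n)] on the error, times the perimeter
   [2 * (hn n + kn n)], equals [c * (hn n * kn n)]. *)
pose eps := c * (h * k) / (2 * (h + k) ^+ 2).
have hk0 : 0 < h + k by rewrite addr_gt0.
have eps0 : 0 < eps.
  by apply: divr_gt0; apply: mulr_gt0 => //; [exact: mulr_gt0|exact: exprn_gt0].
have /contP/(_ _ eps0)[d d0 dP] := cq.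
have [n nd] : exists n, hn n + kn n < d.
  pose n := Num.Def.truncn ((h + k) / d); exists n.
  rewrite -mulrDl ltr_pdivrMr ?exprn_gt0 // mulrC -ltr_pdivrMr //.
  apply: lt_le_trans (truncnS_gt _) _.
  rewrite -natrX ler_nat; exact: ltn_expl.
(* Near the limit point the linear approximation gives the bound at every level, so the rectangle is
   good after all. *)
apply: (sbad n); exists 0%N => m _.
set a := rect_vertex (s n).1 (s n).2.
pose err w := F w - (F z - q z * z + q z * w).
have -> : F = fun w => (F z - q z * z + q z * w) + err w.
  by apply/funext => w; rewrite /err addrC subrK.
rewrite contour_sumD contour_sum_affine add0r.
apply: le_trans (@contour_sum_le _ _ _ _ _ (eps * (hn n + kn n)) _) _; last first.
  rewrite modR gtr0_norm // (_ : modulus (0 +i* kn n) = kn n); last first.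
    by rewrite /modulus /= expr0n add0r sqrtr_sqr gtr0_norm.
  rewrite /eps /hn /kn.
  rewrite le_eqVlt; apply/orP; left; apply/eqP; field.
  rewrite expf_neq0 //= gt_eqF // addr_gt0 //.
move=> t u /andP[t0 t1] /andP[u0 u1].
set w := a + _ + _.
have [/andP[U1 U2] /andP[V1 V2]] := (UP n, VP n).
have wz : modulus (w - z) <= hn n + kn n.
  apply: le_trans (mod_le_ReIm _) _; rewrite !(cReD, cImD, cReN, cImN, cReM, cImM) /=.
  have T1 : 0 <= t * hn n <= hn n by move: (hn0 n) => hp; apply/andP; split; nra.
  have T2 : 0 <= u * kn n <= kn n by move: (kn0 n) => kp; apply/andP; split; nra.
  rewrite !(mulr0, mul0r, subr0, addr0, add0r); case/andP: T1 T2 => ? ? /andP[? ?].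
  by apply: lerD; rewrite ler_norml; apply/andP; split; lra.
have -> : err w = (q w - q z) * (w - z).
  by rewrite /err mulrBl -qP; ring.
rewrite modM; apply: ler_pM => //; try exact: mod_ge0.
by apply/ltW/dP; exact: le_lt_trans wz nd.
Qed.

End Goursat.

(** * Mean value inequality and maximum principle *)

Section MaximumPrinciple.
Context (R : realType).
Implicit Types (g : CC R -> CC R) (a z w : CC R) (v : CC R -> R).

(* The mean value property on the circle, read off Goursat's lemma in logarithmic coordinates.
   The center only needs continuity, so removable singularities come for free. *)
Lemma mean_value_le g a (r s s1 : R) : 0 < r -> {for a, continuous g} ->
  (forall z, z != a -> modulus (z - a) <= r -> hol g z) ->
  (forall z, modulus (z - a) = r -> modulus (g z) <= s) ->
  (forall z, modulus (z - a) = r -> 0 <= Re (z - a) -> 0 <= Im (z - a) ->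
    modulus (g z) <= s1) ->
  modulus (g a) <= (s1 + 3 * s) / 4.
Proof.
move=> r0 cg hg gs gs1; apply/ler_addgt0Pr => e e0.
have [d d0 dP] : exists2 d : R, 0 < d & forall w, modulus (w - a) < d ->
    modulus (g w - g a) < e / 2.
  by move/contP : cg; apply; lra.
pose d' := Num.min d r; have d'0 : 0 < d' by rewrite lt_min d0.
(* Under [a + cexp z] the annulus [d' / 2 <= |z - a| <= r] is the image of a rectangle of width [H]
   and height [2 pi]. *)
pose H := ln (r / (d' / 2)).
have H0 : 0 < H.
  apply: ln_gt0; rewrite ltr_pdivlMr ?mul1r ?divr_gt0 //.
  have : d' <= r by rewrite ge_min lexx orbT.
  by move=> ?; lra.
pose x := ln r - H.
have ex : expR x = d' / 2.
  have rd : r / (d' / 2) \is Num.pos by rewrite posrE !divr_gt0.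
  by rewrite expRB /H !lnK //; field; rewrite !gt_eqF.
have xH : x + H = ln r by rewrite /x subrK.
pose F z := g (a + cexp z).
have FP (u t : R) : modulus (a + cexp (u +i* t) - a) = expR u.
  by rewrite addrC addKr mod_cexp.
have Fhol u t : x <= u <= x + H -> hol F (rect_vertex u t).
  move=> /andP[xu uH].
  have hh := hol_add (hol_cst a (rect_vertex u t)) (hol_cexp (rect_vertex u t)).
  refine (hol_comp _ hh); apply: hg.
    by rewrite -subr_eq0 addrC addKr cexp_neq0.
  by rewrite FP -[leRHS](lnK (r0 : r \is Num.pos)) ler_expR -xH.
have pi0 := pi_gt0 R; pose T : R := pi *+ 2.
have T0 : 0 < T by rewrite mulrn_wgt0.
have e'0 : 0 < e / 2 * T by rewrite mulr_gt0 //; lra.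
have [N HN] := @contour_sum_small _ F x 0 H T H0 T0 (fun u t xu _ => Fhol u t xu) _ e'0.
(* The two extra levels cut the side over the outer circle into four quarter circles, the first of
   which carries the bound [s1]. *)
have {HN} := HN N.+2 (leq_trans (leqnSn _) (leqnSn _)).
set p := rect_vertex x 0; set k : CC R := 0 +i* T.
rewrite /contour_sum [segment_sum F _ (p + k) _]segment_sum_shift.
(* By periodicity the two horizontal sides cancel. *)
have -> : (fun w => F (w + k)) = F by apply/funext => w; rewrite /F /k cexp_period.
set bot := segment_sum F _ p _; set right_ := segment_sum F _ (p + _) k.
set left_ := segment_sum F _ p k.
have -> : bot + right_ - bot - left_ = right_ - left_ by ring.
have mk : modulus k = T.
  by rewrite /modulus /= expr0n add0r sqrtr_sqr gtr0_norm.
move=> HB.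
have L1 : modulus (left_ - g a * k) <= e / 2 * T.
  have -> : left_ - g a * k = segment_sum (fun w => F w + - g a) N.+2 p k.
    by rewrite segment_sumD segment_sum_cst mulNr.
  rewrite -mk; apply: segment_sum_le => t _.
  apply/ltW/dP.
  have -> : p + t%:C * k = x +i* (t * T).
    by apply: CC_eq; rewrite !(cReD, cImD, cReM, cImM) /=; ring.
  rewrite FP ex; have : d' <= d by rewrite ge_min lexx.
  by move=> ?; lra.
have L2 : modulus right_ <= (s1 + 3 * s) / 4 * T.
  have arc (j : nat) (c : R) : (forall t : R, 0 <= t <= 1 ->
      modulus (F (ln r +i* ((j%:R + t) * (T / 4)))) <= c) ->
      modulus (segment_sum F N (ln r +i* (j%:R * (T / 4))) (0 +i* (T / 4))) <= c * (T / 4).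
    move=> cP; have mT : modulus (0 +i* (T / 4) : CC R) = T / 4.
      by rewrite /modulus /= expr0n add0r sqrtr_sqr gtr0_norm // divr_gt0.
    rewrite -[in leRHS]mT; apply: segment_sum_le => t t01.
    have -> : (ln r +i* (j%:R * (T / 4)) : CC R) + t%:C * (0 +i* (T / 4)) =
        ln r +i* ((j%:R + t) * (T / 4)).
      by apply: CC_eq; rewrite !(cReD, cImD, cReM, cImM) /=; ring.
    exact: cP.
  have er : expR (ln r) = r by rewrite lnK.
  have arcs j : modulus (segment_sum F N (ln r +i* (j%:R * (T / 4))) (0 +i* (T / 4)))
      <= s * (T / 4).
    by apply: arc => t _; apply: gs; rewrite FP er.
  have arc0 : modulus (segment_sum F N (ln r +i* (0%:R * (T / 4))) (0 +i* (T / 4)))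
      <= s1 * (T / 4).
    apply: arc => t /andP[t0 t1].
    have -> : T / 4 = pi / 2 by rewrite /T; field.
    have tp : 0 <= t * (pi / 2) <= pi / 2 by apply/andP; split; nra.
    apply: gs1; rewrite ?FP // [a + _]addrC addrK add0r ?Re_cexp ?Im_cexp /=.
      rewrite mulr_ge0 ?expR_ge0 // cos_ge0_pihalf //.
      by case/andP: tp => ? ?; apply/andP; split; lra.
    rewrite mulr_ge0 ?expR_ge0 // sin_ge0_pi //.
    by case/andP: tp => ? ?; apply/andP; split; lra.
  have := arcs 1%N; have := arcs 2%N; have := arcs 3%N; move: arc0.
  rewrite /right_ /=.
  have -> : p + H%:C = ln r +i* (0%:R * (T / 4)).
    by apply: CC_eq; rewrite !(cReD, cImD) /= ?xH; ring.
  have -> : k / 2 / 2 = 0 +i* (T / 4).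
    have -> : k = (0 +i* (T / 4)) + (0 +i* (T / 4)) + (0 +i* (T / 4)) + (0 +i* (T / 4)).
      by apply: CC_eq; rewrite !(cReD, cImD) /=; field.
    by field.
  have -> : k / 2 = (0 +i* (T / 4)) + (0 +i* (T / 4)).
    have -> : k = (0 +i* (T / 4)) + (0 +i* (T / 4)) + (0 +i* (T / 4)) + (0 +i* (T / 4)).
      by apply: CC_eq; rewrite !(cReD, cImD) /=; field.
    by field.
  have sh (j : nat) : (ln r +i* (j%:R * (T / 4)) : CC R) + (0 +i* (T / 4)) =
      ln r +i* (j.+1%:R * (T / 4)).
    by apply: CC_eq; rewrite !(cReD, cImD) /= ?addr0 // -natr1; ring.
  rewrite [_ + (_ +i* _ + _)]addrA !sh.
  set b0 := segment_sum _ _ _ _; set b3 := segment_sum _ _ _ _.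
  set b2 := segment_sum _ _ _ _; set b1 := segment_sum _ _ _ _ => A0 A3 A2 A1.
  have T1 := modD (b0 + b1) (b2 + b3); have T2 := modD b0 b1; have T3 := modD b2 b3.
  lra.
have L3 : modulus (g a * k) <= modulus right_ + e * T.
  have -> : g a * k = right_ - ((right_ - left_) + (left_ - g a * k)) by ring.
  apply: le_trans (modD _ _) _; rewrite modN lerD2l.
  by apply: le_trans (modD _ _) _; lra.
move: L3; rewrite modM mk => L3.
rewrite -(ler_pM2r T0); lra.
Qed.

(* A local representation is enough for the maximum principle, so [v] may be the modulus of a
   multivalued function such as [f(z) z^s]. *)
Definition modulus_hol v a : Prop :=
  exists2 g, {for a, continuous g} & exists2 d : R, 0 < d &
    forall z, modulus (z - a) < d -> v z = modulus (g z) /\ (z != a -> hol g z).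

(** Among the maximum points of [v] take [a] with [Re a + Im a] largest. If [v] is a modulus near
    [a], no maximum point lies on the closed quarter circle above and to the right of [a]; by
    compactness [v] is at most some value less than the maximum there, and the mean value inequality
    fails at [a]. *)
Lemma maximum_principle (K : set (CC R)) v (r c : R) :
  closed K -> (forall z, K z -> modulus z <= r) ->
  (forall z, K z -> {for z, continuous v}) ->
  (forall z, K z -> v z <= c \/
    modulus_hol v z /\ exists2 d : R, 0 < d & forall w, modulus (w - z) < d -> K w) ->
  forall z, K z -> v z <= c.
Proof.
move=> clK bK cv Kv z0 Kz0.
have cK := compact_closed_bounded clK bK.
have K0 : K !=set0 by exists z0.
have cvK : {within K, continuous v}.
  by apply: continuous_in_subspaceT => z /set_mem; exact: cv.
have [b /set_mem Kb bmax] := compact_EVT_max K0 cK cvK.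
pose m := v b; pose Km := [set z | K z /\ v z = m].
have {}bmax z : K z -> v z <= m by move=> /mem_set/bmax.
have clKm : closed Km.
  move=> z clz; have Kz : K z.
    by apply: clK => V /clz[w [[Kw _] Vw]]; exists w.
  split => //; apply/eqP; rewrite eq_le bmax //=; apply/ler_addgt0Pr => e e0.
  have /contRP/(_ _ e0)[d d0 dP] := cv _ Kz.
  have /clz[w [[_ wm] /= /dP]] : nbhs z [set w | modulus (w - z) < d].
    by apply/nbhs_modP; exists d.
  by rewrite wm ltr_norml => /andP[]; lra.
have cKm : compact Km by apply: (@compact_closed_bounded _ _ r clKm) => z [/bK].
have Km0 : Km !=set0 by exists b.
have cl : {within Km, continuous (fun z : CC R => Re z + Im z)}.
  apply: continuous_subspaceT => z.
  exact: (cvgD (@continuous_Re R z) (@continuous_Im R z)).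
have [a /set_mem[Ka va] amax] := compact_EVT_max Km0 cKm cl.
apply: le_trans (bmax _ Kz0) _; rewrite -va.
have [//|[[g cg [d d0 dP]] [d' d'0 d'K]]] := Kv _ Ka.
pose rho := Num.min d d' / 2.
have dd0 : 0 < Num.min d d' by rewrite lt_min d0.
have rho0 : 0 < rho by rewrite divr_gt0.
have rd : rho < d.
  have : Num.min d d' <= d by rewrite ge_min lexx.
  by rewrite /rho; lra.
have rd' : rho < d'.
  have : Num.min d d' <= d' by rewrite ge_min lexx orbT.
  by rewrite /rho; lra.
have ag : v a = modulus (g a) by apply: (dP a _).1; rewrite subrr mod0.
pose arc := [set z : CC R | [/\ modulus (z - a) = rho, 0 <= Re (z - a) & 0 <= Im (z - a)]].
have arcE (z : CC R) : arc z -> Re a + Im a < Re z + Im z.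
  move=> [zr z1 z2]; have := mod_le_ReIm (z - a).
  by move: z1 z2; rewrite zr !cReD !cImD !cReN !cImN => z1 z2; rewrite !ger0_norm //; lra.
have carc : compact arc.
  have -> : arc = [set z | modulus (z - a) <= rho] `&` [set z | rho <= modulus (z - a)]
      `&` [set z : CC R | Re a <= Re z] `&` [set z : CC R | Im a <= Im z].
    apply/seteqP; split => [z [z1 z2 z3]|z [[[/= z1 z2] z3] z4]].
      by rewrite /= z1 lexx; move: z2 z3; rewrite cReD cReN cImD cImN !subr_ge0.
    by split; [apply/eqP; rewrite eq_le z1| rewrite cReD cReN subr_ge0|
      rewrite cImD cImN subr_ge0].
  apply: (@compact_closed_bounded _ _ (rho + modulus a)).
    apply: closedI; last exact/closed_ge_fun/continuous_Im.
    apply: closedI; last exact/closed_ge_fun/continuous_Re.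
    apply: closedI; first exact: closed_mod_le.
    exact/closed_ge_fun/continuous_mod_sub.
  move=> z [[[/= z1 _] _] _]; rewrite -(subrK a z).
  by apply: le_trans (modD _ _) _; rewrite lerD2r.
have arcK z : modulus (z - a) = rho -> K z by move=> zr; apply: d'K; rewrite zr.
have arc0 : arc !=set0.
  exists (a + rho%:C); split; rewrite [a + _]addrC addrK //.
    by rewrite modR gtr0_norm.
  exact: ltW.
have carcv : {within arc, continuous v}.
  by apply: continuous_in_subspaceT => z /set_mem [/arcK Kz _ _]; exact: cv.
have [y /set_mem ya ymax] := compact_EVT_max arc0 carc carcv.
have ym : v y < m.
  rewrite lt_neqAle; have [yr _ _] := ya; rewrite (bmax _ (arcK _ yr)) andbT.
  apply/eqP => vy; have := arcE _ ya; rewrite ltNge => /negP; apply.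
  by apply: amax; apply/mem_set; split => //; exact: arcK.
have : modulus (g a) <= (v y + 3 * m) / 4.
  apply: (mean_value_le rho0 cg).
  - by move=> z za zr; apply: (dP z _).2 => //; exact: le_lt_trans rd.
  - move=> z zr; have <- : v z = modulus (g z) by apply: (dP z _).1; rewrite zr.
    exact/bmax/arcK.
  - move=> z zr z1 z2; have <- : v z = modulus (g z) by apply: (dP z _).1; rewrite zr.
    by apply: ymax; apply/mem_set; split.
by rewrite -ag va; lra.
Qed.

End MaximumPrinciple.

(** * Schwarz, Harnack, logarithms and a covering theorem on discs *)

Section DiscEstimates.
Context (R : realType).
Implicit Types (g h G : CC R -> CC R) (a z w : CC R).

Lemma seq_isolated (E : seq (CC R)) z : exists2 d : R, 0 < d &
  forall w, modulus (w - z) < d -> w \in E -> w = z.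
Proof.
elim: E => [|e E [d d0 dP]]; first by exists 1.
have [ez|ez] := eqVneq e z.
  by exists d => // w wd; rewrite inE => /orP[/eqP ->|] //; exact: dP.
exists (Num.min d (modulus (e - z))) => [|w].
  by rewrite lt_min d0 mod_gt0 subr_eq0.
rewrite lt_min => /andP[wd we]; rewrite inE => /orP[/eqP wE|]; last exact: dP.
by rewrite wE ltxx in we.
Qed.

Lemma modulus_hol_off (E : seq (CC R)) g z (d : R) : 0 < d -> {for z, continuous g} ->
  (forall w, modulus (w - z) < d -> w \notin E -> hol g w) ->
  modulus_hol (fun w => modulus (g w)) z.
Proof.
move=> d0 cg hg; exists g => //; have [d' d'0 d'P] := seq_isolated E z.
exists (Num.min d d'); first by rewrite lt_min d0.
move=> w; rewrite lt_min => /andP[wd wd']; split => // wz; apply: hg => //.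
by apply: contra_neqN wz; exact: d'P.
Qed.

Lemma cont_mod g z : {for z, continuous g} -> {for z, continuous (fun w => modulus (g w))}.
Proof. by move=> cg V /(@continuous_modulus R) /cg. Qed.

(** The list [E] holds the centres of difference quotients, where only continuity is known; being
    finite, it is isolated around each point. *)
Lemma disc_maximum (E : seq (CC R)) g a (r c : R) : 0 < r ->
  (forall z, modulus (z - a) <= r -> {for z, continuous g}) ->
  (forall z, modulus (z - a) <= r -> z \notin E -> hol g z) ->
  (forall z, modulus (z - a) = r -> modulus (g z) <= c) ->
  forall z, modulus (z - a) <= r -> modulus (g z) <= c.
Proof.
move=> r0 cg hg gc.
apply: (@maximum_principle _ _ (fun z => modulus (g z)) (r + modulus a)).
- exact: closed_mod_le.
- by move=> z zr; rewrite -(subrK a z); apply: le_trans (modD _ _) _; rewrite lerD2r.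
- by move=> z /cg; exact: cont_mod.
move=> z; rewrite /= le_eqVlt => /orP[/eqP /gc|zr]; [by left|right].
have rz w : modulus (w - z) < r - modulus (z - a) -> modulus (w - a) <= r.
  by move=> wz; have := mod_triangle w a z; lra.
have rz0 : 0 < r - modulus (z - a) by rewrite subr_gt0.
split; last by exists (r - modulus (z - a)).
apply: (modulus_hol_off rz0); first exact/cg/ltW.
by move=> w /rz; exact: hg.
Qed.

Lemma schwarz h a (d M : R) : 0 < d ->
  (forall z, modulus (z - a) < d -> hol h z /\ modulus (h z - h a) <= M) ->
  forall z, modulus (z - a) < d -> modulus (h z - h a) <= M * (modulus (z - a) / d).
Proof.
move=> d0 hP z zd.
have aa : modulus (a - a) < d by rewrite subrr mod0.
have [q [cq hq _ qh]] := hol_quotient (hP _ aa).1.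
have M0 : 0 <= M by apply: le_trans (hP _ aa).2; exact: mod_ge0.
have K s : modulus (z - a) < s -> s < d -> modulus (h z - h a) * s <= M * modulus (z - a).
  move=> zs sd; have s0 : 0 < s by apply: le_lt_trans zs; exact: mod_ge0.
  have : modulus (q z) <= M / s.
    apply: (@disc_maximum [:: a] q a s _ s0 _ _ _ z (ltW zs)).
    - move=> w ws; have [->//|wa] := eqVneq w a.
      by apply/hol_cont/qh => //; apply: (hP _ _).1; exact: le_lt_trans sd.
    - move=> w ws; rewrite inE => wa.
      by apply: qh => //; apply: (hP _ _).1; exact: le_lt_trans sd.
    - move=> w ws; rewrite ler_pdivlMr // -ws -modM -hq.
      by apply: (hP _ _).2; rewrite ws.
  rewrite hq modM ler_pdivlMr // => qs.
  by rewrite mulrAC ler_wpM2r // mod_ge0.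
rewrite mulrA ler_pdivlMr //.
have [->|hz] := eqVneq (modulus (h z - h a)) 0.
  by rewrite mul0r mulr_ge0 ?mod_ge0.
have hz0 : 0 < modulus (h z - h a) by rewrite lt_neqAle eq_sym hz mod_ge0.
apply/ler_addgt0Pr => e e0.
(* The first entry keeps [z] inside the circle of radius [s]; the second bounds the loss from
   replacing [d] by [s] by [e]. *)
pose s := Num.max ((modulus (z - a) + d) / 2) (d - e / modulus (h z - h a)).
have sd : s < d.
  by rewrite gt_max; apply/andP; split; [lra | rewrite gtrBl divr_gt0].
have zs : modulus (z - a) < s by rewrite lt_max; apply/orP; left; lra.
have := K _ zs sd.
have : d - e / modulus (h z - h a) <= s by rewrite le_max lexx orbT.
rewrite lerBlDr -lerBlDl ler_pdivlMr // => ?; nra.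
Qed.

(* Schwarz's lemma for the Cayley transform of [G] centered at [G a]. *)
Lemma half_plane_harnack G a (d : R) : 0 < d ->
  (forall z, modulus (z - a) < d -> hol G z /\ 0 < Re (G z)) ->
  forall z, modulus (z - a) < d ->
  modulus (G z - G a) * (d - modulus (z - a)) <= 2 * Re (G a) * modulus (z - a).
Proof.
move=> d0 GP z zd.
have aa : modulus (a - a) < d by rewrite subrr mod0.
have Ga0 := (GP _ aa).2.
pose b : CC R := Re (G a) -i* Im (G a).
have den0 w : modulus (w - a) < d -> G w + b != 0.
  by move=> /GP[_ Gw0]; apply: Re_gt0_neq0; rewrite cReD /= addr_gt0.
have le1 w : modulus (w - a) < d -> modulus ((G w - G a) / (G w + b)) <= 1.
  move=> wd; rewrite modM modV ler_pdivrMr ?mod_gt0 ?den0 // mul1r.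
  have Gw0 := (GP _ wd).2.
  rewrite -(@ler_pXn2r _ 2) ?nnegrE ?mod_ge0 // !mod_sqr !(cReD,cImD,cReN,cImN) /=.
  by rewrite !expr2; nra.
have om0 : (G a - G a) / (G a + b) = 0 by rewrite subrr mul0r.
have := @schwarz (fun w => (G w - G a) / (G w + b)) a d 1 d0 _ z zd.
rewrite om0 subr0 mul1r => /(_ _)/wrap[].
  move=> w wd; rewrite ?subr0; split; last exact: le1.
  apply: hol_div; first exact: den0.
    exact: hol_sub (GP _ wd).1 (hol_cst _ _).
  exact: hol_add (GP _ wd).1 (hol_cst _ _).
rewrite modM modV ler_pdivrMr ?mod_gt0 ?den0 // => H.
(* The denominator of the Cayley transform differs from its numerator by a real constant, which
   makes Schwarz's bound linear in [modulus (G z - G a)]. *)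
have : modulus (G z + b) <= modulus (G z - G a) + 2 * Re (G a).
  have -> : G z + b = (G z - G a) + ((2 * Re (G a))%:C).
    by apply: CC_eq; rewrite !(cReD,cImD,cReN,cImN) /=; ring.
  apply: le_trans (modD _ _) _; rewrite lerD2l modR ger0_norm //.
  by rewrite mulr_ge0 // ltW.
move=> H2; have zd0 := mod_ge0 (z - a).
have : modulus (G z - G a) * d <= modulus (z - a) * modulus (G z + b).
  by rewrite -ler_pdivlMr // mulrAC.
nra.
Qed.

Lemma compact_disc_bound g a (r : R) :
  (forall z, modulus (z - a) <= r -> {for z, continuous g}) ->
  exists2 M : R, 0 < M & forall z, modulus (z - a) <= r -> modulus (g z) <= M.
Proof.
move=> cg; have [r0|r0] := ltP r 0.
  by exists 1 => // z zr; exfalso; have := mod_ge0 (z - a); lra.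
have K0 : [set z : CC R | modulus (z - a) <= r] !=set0.
  by exists a; rewrite /= subrr mod0.
have cv : {within [set z | modulus (z - a) <= r], continuous (fun z => modulus (g z))}.
  by apply: continuous_in_subspaceT => z /set_mem /cg; exact: cont_mod.
have [b _ bP] := compact_EVT_max K0 (@compact_disc _ a r) cv.
exists (modulus (g b) + 1); first by have := mod_ge0 (g b); lra.
by move=> z zr; have := bP z (mem_set zr); lra.
Qed.

Lemma compact_disc_away0 g a (r : R) :
  (forall z, modulus (z - a) <= r -> {for z, continuous g} /\ g z != 0) ->
  exists2 m : R, 0 < m & forall z, modulus (z - a) <= r -> m <= modulus (g z).
Proof.
move=> cg; have [|M M0 MP] := @compact_disc_bound (fun z => (g z)^-1) a r.
  by move=> z /cg[cz gz]; exact: cont_inv.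
exists M^-1; first by rewrite invr_gt0.
move=> z zr; have [_ gz] := cg _ zr.
by rewrite -[leRHS]invrK lef_pV2 ?posrE ?invr_gt0 ?mod_gt0 // -modV MP.
Qed.

(* Along each radius the logarithms of ratios of [g] at successive points of a fine subdivision
   add up; Schwarz's lemma makes the ratios close to 1. *)
Lemma hol_log g a (d s : R) : s < d ->
  (forall z, modulus (z - a) < d -> hol g z /\ g z != 0) ->
  exists l : CC R -> CC R, forall z, modulus (z - a) < s -> hol l z /\ cexp (l z) = g z.
Proof.
move=> sd gP; have [s0|s0] := leP s 0.
  by exists id => z zs; exfalso; have := mod_ge0 (z - a); lra.
have [rho rhoE] : exists rho : R, rho = (d - s) / 2 by exists ((d - s) / 2).
have rho0 : 0 < rho by lra.
have [|M M0 MP] := @compact_disc_bound g a (s + rho).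
  by move=> z zr; apply/hol_cont/(gP _ _).1; lra.
have [|m m0 mP] := @compact_disc_away0 g a s.
  by move=> z zs; have [] := gP z (le_lt_trans zs sd) => /hol_cont.
have lip z w : modulus (w - a) <= s -> modulus (z - w) < rho ->
    modulus (g z - g w) <= 2 * M * (modulus (z - w) / rho).
  move=> ws zw; apply: (@schwarz g w rho (2 * M) rho0 _ z zw) => u uw.
  have ua := mod_triangle u a w.
  split; first by apply: (gP _ _).1; lra.
  apply: le_trans (modD _ _) _; rewrite modN.
  have := MP u; have := MP w; lra.
(* With [N] steps, successive points are less than [rho] apart and the values of [g] there differ by
   less than its lower bound [m]. Each ratio is thus within 1 of 1, in the right half-plane. *)
pose N := (Num.Def.truncn (2 * M * s / (rho * m) + s / rho)).+1.
have N0 : 0 < N%:R :> R by rewrite ltr0n.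
have /andP[N1 N2] : (2 * M * (s / N%:R / rho) < m) && (s / N%:R < rho).
  have T : 2 * M * s / (rho * m) + s / rho < N%:R by exact: truncnS_gt.
  have p1 : 0 < 2 * M * s / (rho * m).
    apply: divr_gt0; last exact: mulr_gt0.
    apply: mulr_gt0 => //; exact: mulr_gt0.
  have p2 : 0 < s / rho by rewrite divr_gt0.
  apply/andP; split.
    have : 2 * M * s / (rho * m) < N%:R by lra.
    rewrite ltr_pdivrMr ?mulr_gt0 // => H.
    have -> : 2 * M * (s / N%:R / rho) = 2 * M * s / (N%:R * rho).
      by field; rewrite !gt_eqF.
    by rewrite ltr_pdivrMr ?mulr_gt0 //; lra.
  have : s / rho < N%:R by lra.
  by rewrite !ltr_pdivrMr // mulrC.
pose pt (k : nat) z := a + (k%:R / N%:R : R)%:C * (z - a).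
have ptE k z : pt k z - a = (k%:R / N%:R : R)%:C * (z - a) by rewrite /pt addrC addKr.
have pts k z : (k <= N)%N -> modulus (z - a) < s -> modulus (pt k z - a) <= s.
  move=> kN zs; rewrite ptE modM modR ger0_norm ?divr_ge0 //.
  have : k%:R / N%:R <= 1 :> R by rewrite ler_pdivrMr // mul1r ler_nat.
  have : 0 <= k%:R / N%:R :> R by rewrite divr_ge0.
  have := mod_ge0 (z - a); move: (k%:R / N%:R) => t; nra.
pose rat (k : nat) z := g (pt k.+1 z) / g (pt k z).
have ratP k z : (k < N)%N -> modulus (z - a) < s -> 0 < Re (rat k z).
  move=> kN zs; have ps := pts k z (ltnW kN) zs.
  have gk0 : 0 < modulus (g (pt k z)) by apply: lt_le_trans (mP _ ps).
  have st : modulus (pt k.+1 z - pt k z) < s / N%:R.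
    have -> : pt k.+1 z - pt k z = ((1 / N%:R : R)%:C : CC R) * (z - a).
      have E : (k.+1%:R / N%:R : R)%:C = (k%:R / N%:R : R)%:C + (1 / N%:R : R)%:C :> CC R.
        by rewrite -rmorphD -mulrDl natr1.
      by rewrite /pt E; ring.
    rewrite modM modR ger0_norm ?divr_ge0 // mul1r mulrC ltr_pM2r //.
    by rewrite invr_gt0.
  have : modulus (rat k z - 1) < 1.
    have -> : rat k z - 1 = (g (pt k.+1 z) - g (pt k z)) / g (pt k z).
      by rewrite /rat mulrBl divff // -mod_gt0.
    rewrite modM modV ltr_pdivrMr // mul1r.
    apply: lt_le_trans (mP _ ps); apply: le_lt_trans N1.
    apply: le_trans (lip _ _ ps (lt_trans st N2)) _.
    rewrite ler_pM2l ?mulr_gt0 // ler_pM2r ?invr_gt0 //; exact: ltW.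
  move=> /(le_lt_trans (Re_le_mod _)); rewrite cReD cReN /= ltr_norml => /andP[]; lra.
have [|c0 [c0E _ _]] := @cexp_surj R (g a) 0.
  by apply: (gP _ _).2; rewrite subrr mod0; lra.
exists (fun z => c0 + \sum_(k <- iota 0 N) clog (rat k z)) => z zs; split.
  apply: hol_add; first exact: hol_cst.
  have : all (fun k => (k < N)%N) (iota 0 N) by apply/allP => k; rewrite mem_iota.
  elim: (iota 0 N) => [_|k r IH /= /andP[kN /IH hr]].
    by have := hol_cst 0 z; congr hol; apply/funext => w; rewrite big_nil.
  have hg j : (j <= N)%N -> hol (fun w => g (pt j w)) z.
    move=> jN; apply: (@hol_comp _ g (pt j)).
      by apply: (gP _ _).1; apply: le_lt_trans sd; exact: pts.
    apply: hol_add; first exact: hol_cst.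
    by apply: hol_mul (hol_cst _ _) (hol_sub (hol_id _) (hol_cst _ _)).
  have hk : hol (rat k) z.
    apply: hol_div; [|exact: hg|exact/hg/ltnW].
    by apply: (gP _ _).2; apply: le_lt_trans sd; apply: pts => //; exact: ltnW.
  have := hol_add (hol_comp (hol_clog (ratP k z kN zs)) hk) hr.
  by congr hol; apply/funext => w; rewrite big_cons.
have -> : z = pt N z by rewrite /pt divff ?gt_eqF // mul1r addrC subrK.
have zs' : modulus (pt N z - a) < s.
  by rewrite /pt divff ?gt_eqF // mul1r addrAC subrr add0r.
have ptN : pt N z = z by rewrite /pt divff ?gt_eqF // mul1r addrC subrK.
rewrite ptN.
suff H n : (n <= N)%N -> cexp (c0 + \sum_(k <- iota 0 n) clog (rat k z)) = g (pt n z).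
  by rewrite H // ptN.
elim: n => [_|n IH nN].
  by rewrite big_nil addr0 c0E /pt mul0r mul0r addr0.
rewrite -addn1 iotaD big_cat big_seq1 addrA cexpD IH ?(ltnW nN) // add0n addn1.
rewrite clogK ?ratP // /rat mulrC divfK //.
by apply: (gP _ _).2; apply: le_lt_trans sd; apply: pts => //; exact: ltnW.
Qed.

(** [ln (modulus (g z))] is the real part of a logarithm of [g], positive since [1 < modulus (g z)].
    On the disc of radius [d / 2], where [hol_log] provides it, Harnack's inequality bounds its
    variation up to distance [d / 10] by half the value at [a]. *)
Lemma log_harnack g a (d : R) : 0 < d ->
  (forall z, modulus (z - a) < d -> hol g z /\ 1 < modulus (g z)) ->
  forall z, modulus (z - a) <= d / 10 -> ln (modulus (g a)) <= 2 * ln (modulus (g z)).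
Proof.
move=> d0 gP z zd.
have d2 : d / 2 < d by lra.
have [w /gP[hg g1]|l lP] := @hol_log g a d (d / 2) d2.
  by split => //; rewrite -mod_gt0 (lt_trans ltr01).
have lnE w : modulus (w - a) < d / 2 -> Re (l w) = ln (modulus (g w)).
  by move=> /lP[_ <-]; rewrite mod_cexp expRK.
have d20 : 0 < d / 2 by lra.
have aa : modulus (a - a) < d / 2 by rewrite subrr mod0.
have za : modulus (z - a) < d / 2 by lra.
have := @half_plane_harnack l a (d / 2) d20 _ z za => /(_ _)/wrap[].
  move=> w wd; split; first by have [] := lP _ wd.
  by rewrite lnE // ln_gt0 // (gP _ _).2 //; lra.
rewrite -!lnE // => H.
have := le_trans (ler_norm _) (Re_le_mod (l a - l z)).
have la0 : 0 < Re (l a) by rewrite lnE // ln_gt0 // (gP _ _).2 // subrr mod0.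
move: H; rewrite [modulus (l a - l z)]modBC cReD cReN.
have := mod_ge0 (z - a); have := mod_ge0 (l z - l a).
move: (modulus (l z - l a)) (modulus (z - a)) zd => X t td X0 t0 H RX.
suff : X * d <= (Re (l a) / 2) * d by rewrite ler_pM2r //; lra.
have : X * (d / 10) <= X * (d / 2 - t) - X * (3 / 10 * d) by nra.
have : 2 * Re (l a) * t <= 2 * Re (l a) * (d / 10) by rewrite ler_wpM2l //; lra.
lra.
Qed.

(* If [c] were omitted, Harnack's inequality for [log |(M + 2) / (h - c)|], huge at [a],
   would make [h - c] small at [w] too. *)
Lemma covers_disc h a w (d M e : R) : 0 < d -> 0 < e -> 0 <= M ->
  (forall z, modulus (z - a) < d -> hol h z /\ modulus (h z - h a) <= M) ->
  modulus (w - a) <= d / 10 -> e <= modulus (h w - h a) ->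
  forall c, modulus (c - h a) < Num.min (Num.min 1 (e / 2)) (e ^+ 2 / (8 * (M + 2))) ->
  exists2 z, modulus (z - a) < d & h z = c.
Proof.
move=> d0 e0 M0 hP wd we c; rewrite !lt_min => /andP[/andP[c1 c2] c3].
apply: contrapT => nex.
have om z : modulus (z - a) < d -> h z - c != 0.
  by move=> zd; apply/eqP => /subr0_eq hz; apply: nex; exists z.
have aa : modulus (a - a) < d by rewrite subrr mod0.
(* [modulus (h z - c)] is less than [M + 1], so [Q / (h z - c)] has modulus above 1, as
   [log_harnack] requires. *)
pose Q := M + 2; have Q0 : 0 < Q by rewrite /Q; lra.
have lt1 z : modulus (z - a) < d -> modulus (h z - c) < Q.
  move=> /hP[_ H]; have := mod_triangle (h z) c (h a); rewrite [modulus (h a - c)]modBC /Q.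
  by lra.
have wd' : modulus (w - a) < d by lra.
have := @log_harnack (fun z => (Q%:C : CC R) / (h z - c)) a d d0 _ w wd.
move=> /(_ _)/wrap[].
  move=> z zd; split.
    refine (@hol_div R (fun=> Q%:C) (fun u => h u - c) z (om _ zd) (hol_cst _ z) _).
    exact: hol_sub (hP _ zd).1 (hol_cst _ _).
  rewrite modM modV modR gtr0_norm // ltr_pdivlMr ?mul1r ?lt1 //.
  by rewrite mod_gt0 om.
have ma : 0 < modulus (h a - c) by rewrite mod_gt0 om.
have mw : 0 < modulus (h w - c) by rewrite mod_gt0 om.
have Qa : 0 < Q / modulus (h a - c) by rewrite divr_gt0.
have Qw : 0 < Q / modulus (h w - c) by rewrite divr_gt0.
rewrite !modM !modV !modR gtr0_norm // mulr_natl -lnXn // => H.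
have {H} : Q / modulus (h a - c) <= (Q / modulus (h w - c)) ^+ 2.
  by rewrite -ler_ln // posrE // exprn_gt0.
have -> : (Q / modulus (h w - c)) ^+ 2 = Q * (Q / modulus (h w - c) ^+ 2).
  by field; rewrite gt_eqF.
rewrite ler_pM2l // ler_pdivlMr ?exprn_gt0 // mulrC ler_pdivrMr // => H.
(* Harnack gives [|h w - c|^2 <= Q * |h a - c| < e^2 / 8], which contradicts this lower bound; hence
   the constants in the condition on [c]. *)
have : e / 2 < modulus (h w - c).
  have := mod_triangle (h w) (h a) c; lra.
move: c3; rewrite [modulus (c - _)]modBC ltr_pdivlMr; last by rewrite mulr_gt0 //; lra.
rewrite -/Q => c3 e2.
have : (e / 2) ^+ 2 <= modulus (h w - c) ^+ 2.
  apply: lerXn2r; rewrite ?nnegrE ?mod_ge0 //; last exact: ltW.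
  lra.
have : 0 < e ^+ 2 by rewrite exprn_gt0.
rewrite expr_div_n; move: H c3; move: (modulus (h w - c) ^+ 2) (e ^+ 2) => A B.
by rewrite expr2; lra.
Qed.

End DiscEstimates.

(** * Growth of the maximum modulus and Hadamard's three circles theorem *)

Section MaximumModulus.
Context (R : realType).
Context (f : CC R -> CC R) (hf : forall z, hol f z).

Lemma max_modulus_ub z (r : R) : modulus z = r -> modulus (f z) <= max_modulus f r.
Proof.
move=> zr; have [|M _ MP] := @compact_disc_bound R f 0 r; first by move=> w _; exact: hol_cont.
apply: ub_le_sup; last by exists z.
by exists M => _ [w /= wr <-]; apply: MP; rewrite subr0 wr.
Qed.

Lemma max_modulus_disc z (r : R) : modulus z <= r -> modulus (f z) <= max_modulus f r.
Proof.
move=> zr; have := le_trans (mod_ge0 z) zr; rewrite le_eqVlt => /orP[/eqP r0|r0].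
  by apply: max_modulus_ub; apply/eqP; rewrite -r0 eq_le mod_ge0 andbT r0.
apply: (@disc_maximum R [::] f 0 r _ r0) => [w _|w _ _|w|]; rewrite ?subr0 //.
  exact: hol_cont.
exact: max_modulus_ub.
Qed.

Lemma max_modulus_ge0 (r : R) : 0 <= r -> 0 <= max_modulus f r.
Proof.
by move=> r0; apply: le_trans (mod_ge0 _) (@max_modulus_disc 0 r _); rewrite mod0.
Qed.

(** For each [n] the function [h(z) / (z - a)^n] is entire, as it vanishes near [a]. The maximum
    principle on a disc of radius more than [2 * modulus (w - a)] bounds [h w] by a constant times
    [2^-n]. *)
Lemma hol_identity (h : CC R -> CC R) a (d : R) : (forall z, hol h z) -> 0 < d ->
  (forall z, modulus (z - a) < d -> h z = 0) -> forall z, h z = 0.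
Proof.
move=> hh d0 h0 w.
pose r := 2 * modulus (w - a) + 1.
have m0 := mod_ge0 (w - a).
have r0 : 0 < r by rewrite /r; lra.
have [|M M0 MP] := @compact_disc_bound R h a r; first by move=> z _; exact: hol_cont.
have K n : modulus (h w) <= M * (modulus (w - a) / r) ^+ n.
  pose g z := h z / (z - a) ^+ n.
  have hg z : hol g z.
    have [->|za] := eqVneq z a.
      apply: (@hol_near R (fun=> 0) _ _ d d0) (hol_cst _ _) => u ud.
      by rewrite /g h0 // mul0r.
    have c1 := hol_exp n (hol_sub (hol_id z) (hol_cst a z)).
    by apply: (@hol_div R h (fun u => (u - a) ^+ n)) => //; rewrite expf_neq0 // subr_eq0.
  have wr : modulus (w - a) <= r by rewrite /r; lra.
  have := @disc_maximum R [::] g a r (M / r ^+ n) r0 (fun z _ => hol_cont (hg z))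
    (fun z _ _ => hg z) _ w wr.
  move=> /(_ _)/wrap[z zr|].
    by rewrite modM modV modX zr ler_pM2r ?invr_gt0 ?exprn_gt0 // MP // zr.
  rewrite /g modM modV modX.
  have [wa|wa] := eqVneq (modulus (w - a)) 0.
    have hw : h w = 0 by apply: h0; rewrite wa.
    by move=> _; rewrite hw mod0 mulr_ge0 ?exprn_ge0 ?divr_ge0 // ltW.
  have wa0 : 0 < modulus (w - a) by rewrite lt_def wa.
  rewrite ler_pdivrMr ?exprn_gt0 //.
  by rewrite expr_div_n mulrA mulrAC.
apply/eqP; rewrite -mod_eq0 eq_le mod_ge0 andbT leNgt; apply/negP => hw.
pose n := (Num.Def.truncn (M / modulus (h w))).+1.
have := K n; apply/negP; rewrite -ltNge.
have q1 : modulus (w - a) / r <= 2^-1.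
  by rewrite ler_pdivrMr // /r; lra.
have q0 : 0 <= modulus (w - a) / r by rewrite divr_ge0 // ltW.
apply: (@le_lt_trans _ _ (M * 2^-1 ^+ n)).
  by rewrite ler_pM2l // lerXn2r ?nnegrE // invr_ge0.
rewrite exprVn ltr_pdivrMr ?exprn_gt0 // mulrC -ltr_pdivrMr //.
apply: lt_le_trans (truncnS_gt _) _.
by rewrite -natrX ler_nat ltnW // ltn_expl.
Qed.

Context (fnotpoly : ~ exists p : {poly CC R}, forall z, f z = p.[z]).

(** If equality held, rotate by [u] so that [u * f z = m]. Then [m + e - u * f] has positive real
    part on a disc about [z] and the value [e] at [z]; Harnack's inequality as [e] tends to 0 makes
    [f] constant on the disc, hence everywhere, and so a polynomial. *)
Lemma max_modulus_strict z (r : R) : modulus z < r -> modulus (f z) < max_modulus f r.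
Proof.
move=> zr; rewrite lt_neqAle max_modulus_disc ?ltW // andbT; apply/eqP => fz.
set m := max_modulus f r in fz.
have r0 : 0 < r by apply: le_lt_trans zr; exact: mod_ge0.
have m0 : 0 <= m by apply: max_modulus_ge0; exact: ltW.
pose d := r - modulus z; have d0 : 0 < d by rewrite subr_gt0.
have inr w : modulus (w - z) < d -> modulus w <= r.
  rewrite /d => wz; have := mod_triangle w 0 z; rewrite !subr0; lra.
have fcst w : modulus (w - z) < d -> f w = f z.
  move=> wd.
  have [m00|m00] := eqVneq m 0.
    have f0 u : modulus u <= r -> f u = 0.
      move=> /max_modulus_disc; rewrite -/m m00 => fu; apply/eqP.
      by rewrite -mod_eq0 eq_le fu mod_ge0.
    by rewrite (f0 w (inr _ wd)) (f0 z (ltW zr)).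
  have mp : 0 < m by rewrite lt_def m00.
  pose u : CC R := Re (f z) / m -i* (Im (f z) / m).
  have uf : u * f z = m%:C.
    apply: CC_eq; rewrite ?cReM ?cImM /=; last by ring.
    apply: (@mulIf _ m); first exact: m00.
    by have := mod_sqr (f z); rewrite fz => E; rewrite -[RHS]expr2 E; field.
  have mu : modulus u = 1.
    apply: (@mulIf _ m); first exact: m00.
    by rewrite -{1}fz -modM uf modR ger0_norm // mul1r.
  have u0 : u != 0 by rewrite -mod_gt0 mu.
  have key (e : R) : 0 < e -> modulus (f w - f z) * (d - modulus (w - z)) <=
      2 * e * modulus (w - z).
    move=> e0.
    pose G v := ((m + e)%:C : CC R) - u * f v.
    have := @half_plane_harnack R G z d d0 _ w wd.
    move=> /(_ _)/wrap[v vd|].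
      split; first exact: hol_sub (hol_cst _ _) (hol_mul (hol_cst _ _) (hf v)).
      rewrite cReD cReN /=; have := le_trans (ler_norm _) (Re_le_mod (u * f v)).
      by rewrite modM mu mul1r; have := max_modulus_disc (inr _ vd); rewrite -/m; lra.
    have -> : G w - G z = - (u * (f w - f z)) by rewrite /G; ring.
    rewrite modN modM mu mul1r /G uf.
    have -> : Re ((m + e)%:C - m%:C : CC R) = e by rewrite /=; ring.
    by [].
  apply/eqP; rewrite -subr_eq0 -mod_eq0 eq_le mod_ge0 andbT leNgt; apply/negP => X0.
  have dw : 0 < d - modulus (w - z) by rewrite subr_gt0.
  have P0 : 0 < modulus (f w - f z) * (d - modulus (w - z)) by rewrite mulr_gt0.
  have := @key (modulus (f w - f z) * (d - modulus (w - z)) / (4 * d)).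
  rewrite divr_gt0 ?mulr_gt0 // => /(_ isT).
  move: P0; move: (modulus (f w - f z) * _) => P P0.
  have -> : 2 * (P / (4 * d)) * modulus (w - z) = P * (modulus (w - z) / (2 * d)).
    by field; rewrite gt_eqF.
  rewrite -[leLHS]mulr1 ler_pM2l // ler_pdivlMr ?mulr_gt0 // mul1r; lra.
apply: fnotpoly; exists (f z)%:P => w; rewrite hornerC.
apply/eqP; rewrite -subr_eq0; apply/eqP.
apply: (@hol_identity (fun w => f w - f z) z d) => // [v|v vd].
  exact: hol_sub (hf v) (hol_cst _ _).
by rewrite fcst ?subrr.
Qed.

(* Otherwise [f(z) - f(0)] divided by [z] would be constant, by the maximum principle applied to
   its own difference quotient. *)
Lemma max_modulus_growth : exists2 c : R, 0 < c & exists r0 : R, forall r, r0 <= r ->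
  c * r ^+ 2 <= max_modulus f r.
Proof.
apply: contrapT => nogrowth.
have slow (c r0 : R) : 0 < c -> exists2 r, r0 <= r & max_modulus f r < c * r ^+ 2.
  move=> c0; apply: contrapT => nex; apply: nogrowth; exists c => //; exists r0 => r r0r.
  by rewrite leNgt; apply/negP => fr; apply: nex; exists r.
have [q0 [cq0 fq0 cq0' hq0]] := hol_quotient (hf 0).
have hq0n z : z != 0 -> hol q0 z by move=> z0; exact: hq0.
(* The second quotient is centred at 1, where [q0] is known to be holomorphic; at 0 only its
   continuity is at hand. If [q1] vanishes, [f] is affine. *)
have [q1 [cq1 qq1 cq1' hq1]] := hol_quotient (hq0n 1 (oner_neq0 _)).
have cq1n z : {for z, continuous q1}.
  have [->|z1] := eqVneq z 1; first exact: cq1.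
  have [z0|z0] := eqVneq z 0; last exact: (cq1' z z1 (hol_cont (hq0n z z0))).
  by move: z1; rewrite z0 => z1; exact: (cq1' 0 z1 cq0).
suff q10 z : q1 z = 0.
  apply: fnotpoly; exists ((f 0)%:P + (q0 1)%:P * 'X) => z.
  rewrite hornerD hornerC hornerM hornerC hornerX.
  have := qq1 z; rewrite q10 mul0r => /subr0_eq <-.
  by have := fq0 z; rewrite subr0 => <-; rewrite addrC subrK.
pose C := modulus (f 0) + modulus (q0 1).
have C0 : 0 <= C by rewrite addr_ge0 ?mod_ge0.
have small (e : R) : 0 < e -> modulus (q1 z) <= e.
  move=> e0; have e4 : 0 < e / 4 by lra.
  (* On the circle of radius [r], the bound [2 <= r] controls [modulus (w - 1)] from below,
     [4 * C / e <= r] absorbs the constants [f 0] and [q0 1], and [z] is enclosed. *)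
  have [r rr fr] := slow (e / 4) (Num.max (Num.max 2 (modulus z)) (4 * C / e)) e4.
  move: rr; rewrite !ge_max => /andP[/andP[r2 zr]]; rewrite ler_pdivrMr // => rC.
  have r0 : 0 < r by lra.
  apply: (@disc_maximum R [:: 0; 1] q1 0 r e r0 (fun w _ => cq1n w));
    last by rewrite subr0.
  - move=> w _; rewrite !inE negb_or => /andP[w0 w1'].
    exact: (hq1 w w1' (hq0n w w0)).
  - move=> w; rewrite subr0 => wr; have w1 : 0 < modulus (w - 1).
      by have := modB_ge w 1; rewrite mod1 wr; lra.
    have E1 : modulus (q1 w) * modulus (w - 1) = modulus (q0 w - q0 1).
      by rewrite -modM -qq1.
    have E0 : modulus (q0 w) * r = modulus (f w - f 0).
      by rewrite fq0 subr0 modM wr.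
    have B1 := modD (f w) (- f 0); have B2 := modD (q0 w) (- q0 1).
    rewrite !modN in B1 B2.
    have B3 := max_modulus_ub wr.
    have B4 := modB_ge w 1; rewrite mod1 wr in B4.
    rewrite -(ler_pM2r w1) E1; apply: le_trans B2 _.
    rewrite -(ler_pM2r r0) mulrDl E0.
    have : modulus (q0 1) * r <= modulus (q0 1) * r * 1 by rewrite mulr1.
    have q1ge := mod_ge0 (q0 1); have f0ge := mod_ge0 (f 0).
    move: B1 B3 fr rC; rewrite expr2 /C.
    move: (modulus (f 0)) (modulus (q0 1)) f0ge q1ge (modulus (w - 1)) B4 w1
      (modulus (f w - f 0)) (modulus (f w)) (max_modulus f r) => a b a0 b0 v v1 v0 x y mm.
    move=> xa ym mr rC _.
    have re0 : 0 < r * e by rewrite mulr_gt0.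
    have : (r - 1) * (r * e) <= v * (r * e) by rewrite ler_pM2r.
    have : 4 * (a + b) * r <= r * e * r by rewrite ler_pM2r //; lra.
    have : a <= a * r by rewrite ler_peMr //; lra.
    have : 0 <= (r * e) * (r - 2) by rewrite pmulr_rge0 // subr_ge0.
    lra.
apply/eqP; rewrite -mod_eq0 eq_le mod_ge0 andbT; apply/ler_addgt0Pr => e e0.
by rewrite add0r; exact: small.
Qed.

(** With the slope [al], the function [|f(w)| |w|^(-al)] is at most [expR b] on both boundary
    circles of [1 <= |w| <= r], hence in between. Truncation at 1 takes care of small [z] and of
    small values of [f]. *)
Lemma three_circles (r b : R) z : 1 < r -> 0 <= b -> max_modulus f 1 <= expR b ->
  expR b <= max_modulus f r -> modulus z <= r ->
  ln (Num.max 1 (modulus (f z))) <=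
    b + ln (Num.max 1 (modulus z)) * ((ln (max_modulus f r) - b) / ln r).
Proof.
move=> r1 b0 M1b bMr zr.
have lr0 : 0 < ln r by exact: ln_gt0.
have Mr0 : 0 < max_modulus f r by apply: lt_le_trans bMr; exact: expR_gt0.
have bl : b <= ln (max_modulus f r) by rewrite -[b]expRK ler_ln // posrE expR_gt0.
set al := (ln _ - b) / ln r.
have al0 : 0 <= al by rewrite divr_ge0 ?subr_ge0 // ltW.
have suffle (x y : R) : 0 <= x -> 0 <= y -> x <= expR y -> ln (Num.max 1 x) <= y.
  move=> x0 y0 xy; rewrite -[y]expRK ler_ln ?posrE ?expR_gt0 ?lt_max ?ltr01 //.
  by rewrite ge_max xy andbT -expR0 ler_expR.
have [z1|z1] := leP (modulus z) 1.
  rewrite ln1 mul0r addr0; apply: suffle => //; first exact: mod_ge0.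
  by apply: le_trans M1b; exact: max_modulus_disc.
apply: suffle; first exact: mod_ge0.
  by rewrite addr_ge0 // mulr_ge0 // ln_ge0 // ltW.
have z0 : 0 < modulus z by lra.
pose K := [set z | modulus (z - 0) <= r] `&` [set z : CC R | 1 <= modulus z].
pose v w := modulus (f w) * expR (- al * ln (modulus w)).
suff : v z <= expR b.
  by rewrite /v mulNr expRN ler_pdivrMr ?expR_gt0 // expRD [al * _]mulrC.
apply: (@maximum_principle R K v r (expR b)).
- by apply: closedI; [exact: closed_mod_le | exact/closed_ge_fun/continuous_modulus].
- by move=> w [/=]; rewrite subr0.
- move=> w [_ /= w1]; have w0 : 0 < modulus w by lra.
  apply: (cvgM (cont_mod (hol_cont (hf w)))).
  have c1 : {for w, continuous (fun u => ln (modulus u))}.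
    by move=> V /(@continuous_ln R _ w0)/(@continuous_modulus R).
  have c2 : {for w, continuous (fun u => - al * ln (modulus u))}.
    exact: (cvgM (@cst_continuous _ _ (- al : R) w) c1).
  by move=> V /(@continuous_expR R)/c2.
- move=> w [/=]; rewrite subr0 => wr w1.
  have [wE|wr'] := eqVneq (modulus w) r.
    left; rewrite /v wE mulNr expRN ler_pdivrMr ?expR_gt0 // -expRD /al divfK ?gt_eqF //.
    by rewrite addrC subrK lnK ?posrE // max_modulus_ub.
  have [wE|w1'] := eqVneq (modulus w) 1.
    left; rewrite /v wE ln1 mulr0 expR0 mulr1; apply: le_trans M1b.
    exact: max_modulus_ub.
  have {}wr' : modulus w < r by rewrite lt_def eq_sym wr'.
  have {}w1' : 1 < modulus w by rewrite lt_def w1'.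
  have w0 : w != 0 by rewrite -mod_gt0; lra.
  right; split; last first.
    exists (Num.min (r - modulus w) (modulus w - 1)); first by rewrite lt_min !subr_gt0 wr'.
    move=> u; rewrite lt_min => /andP[u1 u2]; have := mod_dist u w.
    rewrite ler_norml => /andP[? ?]; split => /=; rewrite ?subr0; lra.
  (* Dividing by [w] brings [u] into the right half-plane, where [clog] is a logarithm; the last
     factor restores [|w|^(-al)]. *)
  pose g u := f u * cexp (((- al)%:C : CC R) * clog (u / w)) *
    ((expR (- al * ln (modulus w)))%:C : CC R).
  have near0 u : modulus (u - w) < modulus w -> 0 < Re (u / w).
    move=> uw; have : modulus (u / w - 1) < 1.
      have -> : u / w - 1 = (u - w) / w by rewrite mulrBl divff.
      by rewrite modM modV ltr_pdivrMr ?mul1r //; lra.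
    move=> /(le_lt_trans (Re_le_mod _)); rewrite cReD cReN /= ltr_norml => /andP[]; lra.
  have mw0 : 0 < modulus w by lra.
  have hg u : modulus (u - w) < modulus w -> hol g u.
    move=> uw; have h1 := hol_mul (hol_id u) (hol_cst w^-1 u).
    have h2 := @hol_comp R (@clog R) (fun t => t / w) u (hol_clog (near0 _ uw)) h1.
    have h3 := @hol_comp R (@cexp R) (fun t => ((- al)%:C : CC R) * clog (t / w)) u
      (hol_cexp _) (hol_mul (hol_cst _ u) h2).
    exact: hol_mul (hol_mul (hf u) h3) (hol_cst _ _).
  exists g; first by apply: hol_cont; apply: hg; rewrite subrr mod0.
  exists (modulus w) => // u uw; split; last by move=> _; exact: hg.
  have u0 : 0 < modulus u.
    by have := mod_dist u w; rewrite ler_norml => /andP[]; lra.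
  rewrite /v /g modM [modulus (f u * _)]modM mod_cexp modR ger0_norm ?expR_ge0 // -mulrA -expRD.
  congr (_ * expR _); rewrite cReM /= mul0r subr0 modM modV ln_div ?posrE //; ring.
by split; rewrite /= ?subr0 // ltW.
Qed.

(* With [t = ln r_n] and [y = ln+ |f^n w|], three circles gives
   1 - y'/t' >= (1 - b/t') (1 - y/t), and the infinite product of the factors converges
   because [t] grows geometrically. *)
Lemma relative_gap (rho : R) w : 0 < rho ->
  iter n (max_modulus f) rho @[n --> \oo] --> +oo -> ~ fast_escaping_AR f rho w ->
  exists2 e : R, 0 < e & exists N, forall n, (N <= n)%N ->
    [/\ 1 < iter n (max_modulus f) rho,
        modulus (iter n f w) < iter n (max_modulus f) rho &
        ln (modulus (iter n f w)) <= (1 - e) * ln (iter n (max_modulus f) rho)].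
Proof.
move=> rho0 roo nA.
pose r n := iter n (max_modulus f) rho; pose x n := modulus (iter n f w).
have [k xk] : exists k, x k < r k.
  apply: contrapT => nex; apply: nA => n _; rewrite leNgt; apply/negP => H.
  by apply: nex; exists n.
have xr n : (k <= n)%N -> x n < r n.
  elim: n => [|n IH]; first by rewrite leqn0 => /eqP k0; rewrite k0 in xk.
  rewrite leq_eqVlt ltnS => /orP[/eqP <-//|/IH]; rewrite /x /r !iterS.
  exact: max_modulus_strict.
have [c c0 [r0 growth]] := max_modulus_growth.
pose b := ln (Num.max 1 (max_modulus f 1)).
have b0 : 0 <= b by rewrite ln_ge0 // le_max lexx.
have eb : expR b = Num.max 1 (max_modulus f 1) by rewrite lnK // posrE lt_max ltr01.
(* When [T <= t n], the term [4 * b] gives [b / t n <= 1 / 4], and [2 * |ln c|] turns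
   [t n.+1 >= 2 * t n + ln c] into growth by the factor [3 / 2]. *)
pose T := 1 + 4 * b + 2 * `|ln c|.
have T1 : 1 <= T by rewrite /T; have := normr_ge0 (ln c); lra.
have [N NP] : exists N, forall n, (N <= n)%N -> Num.max r0 (expR T) <= r n.
  have /cvgryPge/(_ (Num.max r0 (expR T))) [N _ NP] := roo.
  by exists N => n /NP.
have rbig n : (N <= n)%N -> [/\ r0 <= r n, 0 < r n & T <= ln (r n)].
  move=> /NP; rewrite ge_max => /andP[r0n Tn].
  have rn0 : 0 < r n by apply: lt_le_trans Tn; exact: expR_gt0.
  by split => //; rewrite -[T]expRK ler_ln // posrE expR_gt0.
pose t n := ln (r n); pose y n := ln (Num.max 1 (x n)).
have tT n : (N <= n)%N -> T <= t n by move=> /rbig[].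
have r1 n : (N <= n)%N -> 1 < r n.
  move=> Nn; have [_ rn0 Tn] := rbig _ Nn; rewrite ltNge; apply/negP => rn1.
  by have := ln_le0 rn1; lra.
have tS n : (N <= n)%N -> 3 / 2 * t n <= t n.+1.
  move=> Nn; have [rn0 rnp _] := rbig _ Nn; have [_ rSp _] := rbig _ (leqW Nn).
  have := growth _ rn0; rewrite -[max_modulus f _]/(r n.+1).
  rewrite -ler_ln ?posrE // ?mulr_gt0 ?exprn_gt0 // lnM ?posrE ?exprn_gt0 // lnXn //.
  rewrite -/(t n) -/(t n.+1) -mulr_natl; have := tT _ Nn; rewrite /T.
  by have := ler_norm (- ln c); rewrite normrN; lra.
have y0 n : 0 <= y n by rewrite ln_ge0 // le_max lexx.
have yS n : (N <= n)%N -> (k <= n)%N -> y n.+1 <= b + y n * ((t n.+1 - b) / t n).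
  move=> Nn kn; apply: three_circles => //; first exact: r1.
  - by rewrite eb le_max lexx orbT.
  - have [_ rSp Tn] := rbig _ (leqW Nn).
    rewrite -[max_modulus f _]/(r n.+1) -[r n.+1]lnK ?posrE // ler_expR.
    by apply: le_trans Tn; rewrite /T; have := normr_ge0 (ln c); lra.
  - exact/ltW/xr.
pose lam n := 1 - y n / t n.
have lamS n : (N <= n)%N -> (k <= n)%N -> lam n * (1 - b / t n.+1) <= lam n.+1.
  move=> Nn kn; have := yS _ Nn kn; have Tn := tT _ Nn; have TSn := tT _ (leqW Nn).
  have tn0 : 0 < t n by lra.
  have tS0 : 0 < t n.+1 by lra.
  move=> H; rewrite /lam -(ler_pM2r tS0).
  have -> : (1 - y n / t n) * (1 - b / t n.+1) * t n.+1 =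
     t n.+1 - (b + y n * ((t n.+1 - b) / t n)).
    by field; rewrite !gt_eqF.
  have -> : (1 - y n.+1 / t n.+1) * t n.+1 = t n.+1 - y n.+1 by field; rewrite gt_eqF.
  lra.
pose n0 := maxn N k.
have lam0 : 0 < lam n0.
  have Nn : (N <= n0)%N by rewrite leq_maxl.
  have tn0 : 0 < t n0 by have := tT _ Nn; lra.
  rewrite subr_gt0 ltr_pdivrMr // mul1r ltr_ln ?posrE ?lt_max ?ltr01 //.
    by rewrite gt_max r1 //= xr // leq_maxr.
  by have [] := rbig _ Nn.
have bt n : (N <= n)%N -> 0 <= b / t n <= 4^-1.
  move=> Nn; have Tn := tT _ Nn; have tn0 : 0 < t n by lra.
  apply/andP; split; first by rewrite divr_ge0 // ltW.
  rewrite ler_pdivrMr //.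
  by move: Tn; rewrite /T; have := normr_ge0 (ln c); lra.
have btS n : (N <= n)%N -> 3 / 2 * (b / t n.+1) <= b / t n.
  move=> Nn; have Tn := tT _ Nn; have tn0 : 0 < t n by lra.
  have tS0 : 0 < t n.+1 by have := tT _ (leqW Nn); lra.
  rewrite mulrA ler_pdivrMr // [b / t n * _]mulrAC ler_pdivlMr //.
  by have := tS _ Nn; nra.
(* This corrected gap is nondecreasing and takes the place of the infinite product: with
   [u = b / t n], [u' = b / t n.+1] and [3 * u' <= 2 * u], one has [(1 - u') * (1 - 2 * u') >= 1 - 3
   * u' >= 1 - 2 * u]. *)
pose mu n := lam n * (1 - 2 * (b / t n)).
have muP n : mu n0 <= mu (n0 + n)%N /\ 0 < lam (n0 + n)%N.
  elim: n => [|n [I1 I2]]; first by rewrite addn0.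
  have Nn : (N <= n0 + n)%N by rewrite (leq_trans _ (leq_addr _ _)) // leq_maxl.
  have kn : (k <= n0 + n)%N by rewrite (leq_trans _ (leq_addr _ _)) // leq_maxr.
  have := lamS _ Nn kn; have /andP[B1 B2] := bt _ Nn; have /andP[B3 B4] := bt _ (leqW Nn).
  have := btS _ Nn; rewrite addnS; move: I1 I2; rewrite /mu.
  move: (lam (n0 + n)%N) (lam (n0 + n).+1) (b / t (n0 + n)%N) (b / t (n0 + n).+1) B1 B2 B3 B4.
  move=> l l' u u' u0 u4 u'0 u'4 I1 l0 uu ll.
  have l'0 : 0 < l' by apply: lt_le_trans ll; rewrite mulr_gt0 //; lra.
  split => //; apply: le_trans I1 _.
  have : l * (1 - u') * (1 - 2 * u') <= l' * (1 - 2 * u') by rewrite ler_wpM2r //; lra.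
  apply: le_trans; rewrite -mulrA ler_pM2l //.
  have : 0 <= u' * u' by rewrite mulr_ge0.
  lra.
exists (mu n0).
  have /andP[B1 B2] := bt n0 (leq_maxl _ _).
  by rewrite mulr_gt0 //; lra.
exists n0 => n n0n.
have Nn : (N <= n)%N by apply: leq_trans n0n; rewrite leq_maxl.
have kn : (k <= n)%N by apply: leq_trans n0n; rewrite leq_maxr.
split; [exact: r1 | exact: xr |].
have [+ lamn] := muP (n - n0)%N; rewrite subnKC // in lamn *.
move=> mun; have /andP[B1 B2] := bt _ Nn.
have tn0 : 0 < t n by have := tT _ Nn; lra.
have lamle : mu n0 <= lam n.
  apply: le_trans mun _; rewrite /mu ler_piMr //; [exact: ltW | lra].
apply: (@le_trans _ _ (y n)).
  have [x1|x1] := leP (x n) 1.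
    by apply: le_trans (y0 n); exact: ln_le0.
  by rewrite /y max_r // ltW.
have -> : y n = (1 - lam n) * t n by rewrite /lam; field; rewrite gt_eqF.
by rewrite ler_pM2r //; lra.
Qed.

End MaximumModulus.

(** * Escaping orbits and normality; components of open complements *)

Section FatouCriteria.
Context (R : realType).
Implicit Types (f : CC R -> CC R) (z w a b : CC R).

Lemma hol_iter f n z : (forall w, hol f w) -> hol (iter n f) z.
Proof.
move=> hf; elim: n => [|n IH]; first exact: hol_id.
by have := @hol_comp R f (iter n f) z (hf _) IH.
Qed.

Lemma chordal_sym (a b : option (CC R)) : chordal a b = chordal b a.
Proof.
case: a b => [a|] [b|] //=; rewrite modBC; congr (_ / _); exact: mulrC.
Qed.

Lemma sqrt1D_gt0 (x : R) : 0 < Num.sqrt (1 + x ^+ 2).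
Proof. by rewrite sqrtr_gt0; have := sqr_ge0 x; lra. Qed.

Lemma sqrt1D_lipschitz a b :
  Num.sqrt (1 + modulus a ^+ 2) <= modulus (a - b) + Num.sqrt (1 + modulus b ^+ 2).
Proof.
have s0 := sqrt1D_gt0 (modulus b); have m0 := mod_ge0 (a - b).
rewrite -(@ler_pXn2r _ 2) ?nnegrE ?addr_ge0 ?(ltW s0) ?sqrtr_ge0 //.
rewrite sqr_sqrtr; last by have := sqr_ge0 (modulus a); lra.
rewrite sqrrD sqr_sqrtr; last by have := sqr_ge0 (modulus b); lra.
have bs : modulus b <= Num.sqrt (1 + modulus b ^+ 2).
  rewrite -[leLHS]ger0_norm ?mod_ge0 // -sqrtr_sqr ler_wsqrtr //; lra.
have := modD (a - b) b; rewrite subrK => ab.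
have : modulus a ^+ 2 <= (modulus (a - b) + modulus b) ^+ 2.
  by rewrite lerXn2r // nnegrE ?addr_ge0 ?mod_ge0.
rewrite sqrrD; have : modulus (a - b) * modulus b <=
    modulus (a - b) * Num.sqrt (1 + modulus b ^+ 2) by rewrite ler_wpM2l.
rewrite !mulr2n; lra.
Qed.

(** With infinity as an end point, the triangle inequality amounts to [sqrt (1 + |.|^2)] being
    1-Lipschitz. *)
Lemma chordal_None_triangle (a b : option (CC R)) :
  chordal a None <= chordal a b + chordal b None.
Proof.
have pos c : 0 <= 2 / Num.sqrt (1 + modulus c ^+ 2) by rewrite divr_ge0 // sqrtr_ge0.
case: a b => [a|] [b|] /=; rewrite ?addr0 //.
have sa := sqrt1D_gt0 (modulus a); have sb := sqrt1D_gt0 (modulus b).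
have := sqrt1D_lipschitz b a; rewrite [modulus (b - a)]modBC.
move: sa sb; move: (Num.sqrt (1 + modulus a ^+ 2)) (Num.sqrt (1 + modulus b ^+ 2)).
move=> s t s0 t0 H.
have -> : 2 * modulus (a - b) / (s * t) + 2 / t = 2 * (modulus (a - b) + s) / (s * t).
  by field; rewrite !gt_eqF.
have -> : 2 / s = 2 * t / (s * t) by field; rewrite !gt_eqF.
by rewrite ler_pM2r ?invr_gt0 ?mulr_gt0 // ler_pM2l.
Qed.

Lemma chordal_None_lt a (e : R) : 0 < e -> 2 / e < modulus a -> chordal (Some a) None < e.
Proof.
move=> e0 ea /=; have m0 : 0 < modulus a by apply: lt_trans ea; rewrite divr_gt0.
rewrite ltr_pdivrMr ?sqrt1D_gt0 // mulrC -ltr_pdivrMr //; apply: lt_le_trans ea _.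
rewrite -[leLHS]ger0_norm ?mod_ge0 // -sqrtr_sqr ler_wsqrtr //; lra.
Qed.

Lemma chordal_None_ge a : modulus a <= 1 -> 1 <= chordal (Some a) None.
Proof.
move=> a1 /=; rewrite ler_pdivlMr ?sqrt1D_gt0 // mul1r.
rewrite -(@ler_pXn2r _ 2) ?nnegrE ?sqrtr_ge0 // sqr_sqrtr; last first.
  by have := sqr_ge0 (modulus a); lra.
have := mod_ge0 a; rewrite !expr2 => ?; nra.
Qed.

Lemma homo_ltn_ge (k : nat -> nat) : {homo k : m n / (m < n)%N} -> forall n, (n <= k n)%N.
Proof.
by move=> hk; elim=> // n IH; apply: leq_ltn_trans IH (hk _ _ _).
Qed.

(** Otherwise there are points tending to [z] and exponents tending to infinity whose images lie in
    the unit disc. Along a convergent subsequence, such an image is compared with one fixed large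
    iterate at the same point [w]: both are near [g w], yet one is in the unit disc and the other
    near infinity. *)
Lemma fatou_escape f z : (forall w, hol f w) -> fatou_set f z ->
  (forall K : R, exists N, forall n, (N <= n)%N -> K <= modulus (iter n f z)) ->
  exists2 d : R, 0 < d & exists N, forall n w, (N <= n)%N -> modulus (w - z) < d ->
    1 < modulus (iter n f w).
Proof.
move=> hf [U [oU Uz] normU] esc; apply: contrapT => nesc.
have pick (j : nat) : exists p : nat * CC R,
    [/\ (j < p.1)%N, modulus (p.2 - z) < j.+1%:R^-1 & modulus (iter p.1 f p.2) <= 1].
  apply: contrapT => nex; apply: nesc; exists j.+1%:R^-1; first by rewrite invr_gt0.
  exists j.+1 => n w jn wz; rewrite ltNge; apply/negP => fw.
  by apply: nex; exists (n, w).
have [p pP] := choice pick.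
have [j|k hk [g cvg_g]] := normU (fun j => iter (p j).1 f).
  by exists (p j).1 => //; have [+ _ _] := pP j; case: (p j).1.
have kge := homo_ltn_ge hk.
have [V /nbhs_modP[d1 d10 dV] VP] := cvg_g z Uz.
(* Three distances below [1 / 5] cannot join the unit disc to infinity, which are at chordal
   distance at least 1. A modulus above [10 = 2 / (1 / 5)] puts a value within [1 / 5] of infinity,
   hence the 10 and 11 below. *)
have [|J _ JP] := VP (1 / 5) _; first by rewrite divr_gt0.
have [d2 d20 dU] : exists2 d : R, 0 < d & forall w, modulus (w - z) < d -> U w.
  by apply/nbhs_modP; exact: open_nbhs_nbhs.
have [N1 HN1] := esc 11.
pose j0 := maxn J N1; pose n0 := (p (k j0)).1.
have n0N : (N1 <= n0)%N.
  have [+ _ _] := pP (k j0) => /ltnW; apply: leq_trans.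
  by apply: leq_trans (kge j0); rewrite leq_maxr.
have [d3 d30 d3P] : exists2 d : R, 0 < d & forall w, modulus (w - z) < d ->
    10 < modulus (iter n0 f w).
  have /contRP/(_ 1 ltr01)[d d0 dP] := cont_mod (hol_cont (hol_iter n0 z hf)).
  exists d => // w /dP; rewrite ltr_norml => /andP[+ _].
  by have := HN1 _ n0N; lra.
pose d := Num.min (Num.min d1 d2) d3.
have d0 : 0 < d by rewrite !lt_min d10 d20.
pose j := maxn J (Num.Def.truncn d^-1).
have [_ wz fw] := pP (k j); set w := (p (k j)).2 in wz fw.
have wd : modulus (w - z) < d.
  apply: lt_trans wz _; rewrite invf_plt ?posrE //.
  apply: lt_le_trans (truncnS_gt _) _; rewrite ler_nat ltnS.
  by apply: leq_trans (kge j); rewrite leq_maxr.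
move: wd; rewrite !lt_min => /andP[/andP[wd1 wd2] wd3].
have UVw : (U `&` V) w by split; [exact: dU | exact: dV].
have A1 := JP j (leq_maxl _ _) w UVw; have A2 := JP j0 (leq_maxl _ _) w UVw.
have A3 : chordal (Some (iter n0 f w)) None < 1 / 5.
  by apply: chordal_None_lt; [lra | have := d3P _ wd3; lra].
have B1 := chordal_None_ge fw.
have B2 := chordal_None_triangle (Some (iter (p (k j)).1 f w)) (g w).
have B3 := chordal_None_triangle (g w) (Some (iter n0 f w)).
rewrite [chordal (g w) (Some _)]chordal_sym in B3.
have {}A1 : chordal (Some (iter (p (k j)).1 f w)) (g w) < 1 / 5 := A1.
have {}A2 : chordal (Some (iter n0 f w)) (g w) < 1 / 5 := A2.
lra.
Qed.

(** In a sequence of iterates either one exponent occurs infinitely often, giving a constant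
    subsequence, or the exponents tend to infinity, and the sequence itself converges to infinity
    uniformly on the disc. *)
Lemma escape_fatou f z (d : R) : 0 < d ->
  (forall K : R, exists N, forall n w, (N <= n)%N -> modulus (w - z) < d ->
    K <= modulus (iter n f w)) -> fatou_set f z.
Proof.
move=> d0 esc; exists [set w | modulus (w - z) < d].
  split; last by rewrite /= subrr mod0.
  rewrite openE => w /= wz; apply/nbhs_modP; exists (d - modulus (w - z)).
    by rewrite subr_gt0.
  by move=> u uw /=; have := mod_triangle u z w; lra.
move=> u uF; have /choice[p pP] : forall i, exists n, u i = iter n f.
  by move=> i; have [n _ ->] := uF i; exists n.
have cvgI (k : nat -> nat) g : (forall e : R, 0 < e -> \forall n \near \oo,
    forall w, modulus (w - z) < d -> chordal (Some (u (k n) w)) (g w) < e) ->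
    cvg_locally_uniformly [set w | modulus (w - z) < d] (u \o k) g.
  move=> H w wz; exists setT; first exact: filterT.
  by move=> e /H[N _ NP]; exists N => // n /NP Hn v [/= vd _]; exact: Hn.
have [[q qP]|nfreq] := pselect (exists q, forall N, exists2 i, (N < i)%N & p i = q).
  have /choice[nx nxP] : forall N, exists i, (N < i)%N /\ p i = q.
    by move=> N; have [i Ni pi] := qP N; exists i.
  pose k := fix k n := if n is n'.+1 then nx (k n') else nx 0%N.
  have pk n : p (k n) = q.
    by case: n => [|n] /=; [have [] := nxP 0%N | have [] := nxP (k n)].
  exists k.
    by apply: homo_ltn; [exact: ltn_trans|move=> n /=; have [] := nxP (k n)].
  exists (fun w => Some (iter q f w)); apply: cvgI => e e0.
  by exists 0%N => // n _ w _; rewrite pP pk /= subrr mod0 mulr0 mul0r.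
have large q : exists N, forall i, (N < i)%N -> (q <= p i)%N.
  elim: q => [|q [N NP]]; first by exists 0%N.
  have [N' NP'] : exists N', forall i, (N' < i)%N -> p i <> q.
    apply: contrapT => nex; apply: nfreq; exists q => N'; apply: contrapT => nex'.
    by apply: nex; exists N' => i Ni pi; apply: nex'; exists i.
  exists (maxn N N') => i; rewrite gtn_max => /andP[/NP qi /NP' piq].
  by rewrite ltn_neqAle qi andbT eq_sym; apply/eqP.
exists id => //; exists (fun=> None); apply: cvgI => e e0.
have [N NP] := esc (2 / e + 1); have [N' NP'] := large N.
exists N'.+1 => // n /= Nn w wz; rewrite pP; apply: chordal_None_lt => //.
by have := NP _ w (NP' _ Nn) wz; lra.
Qed.

Lemma ball_connected z (d : R) : connected [set w : CC R | modulus (w - z) < d].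
Proof.
have [d0|d0] := leP d 0.
  have -> : [set w : CC R | modulus (w - z) < d] = set0.
    by apply/seteqP; split => // w /=; have := mod_ge0 (w - z); lra.
  exact: connected0.
pose seg (w : CC R) := (fun t : R => z + (t%:C : CC R) * (w - z)) @` `[0, 1].
have -> : [set w : CC R | modulus (w - z) < d] =
    \bigcup_(w in [set w | modulus (w - z) < d]) seg w.
  apply/seteqP; split => [w wd|_ [w /= wd [t /= t01 <-]]].
    exists w => //; exists 1; first by rewrite /= in_itv /= ler01 lexx.
    by rewrite mul1r addrC subrK.
  rewrite addrC addKr modM modR; move: t01; rewrite in_itv /= => /andP[t0 t1].
  by rewrite ger0_norm //; have := mod_ge0 (w - z); nra.
apply: bigcup_connected.
  exists z => w _; exists 0; first by rewrite /= in_itv /= ler01 lexx.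
  by rewrite mul0r addr0.
move=> w _; apply: connected_continuous_connected; first exact: segment_connected.
apply: continuous_subspaceT => t; apply/contCP => e e0.
pose c := modulus (w - z) + 1; have c0 : 0 < c by rewrite /c; have := mod_ge0 (w - z); lra.
exists (e / c) => [|s st]; first by rewrite divr_gt0.
have -> : z + s%:C * (w - z) - (z + t%:C * (w - z)) = ((s - t)%:C : CC R) * (w - z).
  by rewrite rmorphB; ring.
rewrite modM modR; move: st; rewrite ltr_pdivlMr //; apply: le_lt_trans.
by rewrite ler_wpM2l //; rewrite /c; lra.
Qed.

(** A disc about a boundary point off [A], itself off [A], would meet the component and hence be
    part of it, making the point interior. *)
Lemma boundary_component_sub (A : set (CC R)) z : closed A ->
  boundary (connected_component (~` A) z) `<=` A.
Proof.
move=> clA w [clw intw]; apply: contrapT => nAw; apply: intw.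
have /nbhs_modP[d d0 dA] : nbhs w (~` A).
  by apply: open_nbhs_nbhs; split => //; exact: closed_openC.
have [u [Hu /= uw]] : connected_component (~` A) z `&` [set u | modulus (u - w) < d] !=set0.
  by apply: clw; apply/nbhs_modP; exists d.
apply/nbhs_modP; exists d => // v vw.
apply: (connected_component_trans Hu).
apply: (@connected_component_max _ _ [set v | modulus (v - w) < d]) => //.
exact: ball_connected.
Qed.

Lemma closed_fast_escaping f (rho : R) : (forall z, hol f z) ->
  closed (fast_escaping_AR f rho).
Proof.
move=> hf z clz n n0.
pose C := [set w | iter n (max_modulus f) rho <= modulus (iter n f w)].
have clC : closed C.
  by apply: closed_ge_fun => w; exact: cont_mod (hol_cont (hol_iter n w hf)).
by apply: clC => V /clz[w [/(_ n n0) Cw Vw]]; exists w.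
Qed.

End FatouCriteria.

(** * From one Fatou point on the loop to the whole loop *)

Section LoopInFatou.
Context (R : realType) (f : CC R -> CC R) (rho : R).
Context (hf : forall z, hol f z).
Context (fnotpoly : ~ exists p : {poly CC R}, forall z, f z = p.[z]).
Context (rho0 : (0 : R) < rho).
Context (roo : iter n (max_modulus f) rho @[n --> \oo] --> +oo).

Local Notation A := (fast_escaping_AR f rho).
Local Notation r n := (iter n (max_modulus f) rho).

Lemma ln_radius_large (K : R) : exists N, forall n, (N <= n)%N ->
  [/\ (0 < n)%N, 1 < r n & K <= ln (r n)].
Proof.
have /cvgryPge/(_ (expR (Num.max K 1))) [N _ NP] := roo.
exists (maxn N 1) => n; rewrite geq_max => /andP[/NP /= H n0].
have rn0 : 0 < r n by apply: lt_le_trans H; exact: expR_gt0.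
have K1 : Num.max K 1 <= ln (r n) by rewrite -[Num.max K 1]expRK ler_ln // posrE expR_gt0.
split=> //; last by apply: le_trans K1; rewrite le_max lexx.
apply: lt_le_trans H; by rewrite -[ltLHS]expR0 ltr_expR lt_max ltr01 orbT.
Qed.

Lemma not_AR_below w : ~ A w -> exists N, forall n, (N <= n)%N -> modulus (iter n f w) < r n.
Proof.
by move=> /(relative_gap hf fnotpoly rho0 roo)[e _ [N NP]]; exists N => n /NP[].
Qed.

Lemma AR_ln_ge z n : (0 < n)%N -> 1 < r n -> A z -> ln (r n) <= ln (modulus (iter n f z)).
Proof. by move=> n0 r1 /(_ n n0) H; rewrite ler_ln // posrE; lra. Qed.

(** A point outside [A] violates the defining inequality at all late times, so membership can be
    read off the tail of the orbit. *)
Lemma iter_eq_AR z w n : iter n f z = iter n f w -> A w -> A z.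
Proof.
move=> zw Aw; apply: contrapT => /not_AR_below[N NP].
have := NP (N + n).+1 (leqW (leq_addr _ _)); apply/negP; rewrite -leNgt.
have -> : iter (N + n).+1 f z = iter (N + n).+1 f w by rewrite -addSn !iterD zw.
exact: Aw.
Qed.

(** * Logarithms of the iterates on a disc about a Fatou point of the loop *)

Section Near.
Context (z0 : CC R) (D : R) (D0 : (0 : R) < D) (N0 : nat) (l : nat -> CC R -> CC R).
Context (lP : forall n, (N0 <= n)%N -> forall z, modulus (z - z0) < D ->
  [/\ hol (l n) z, cexp (l n z) = iter n f z & 0 < Re (l n z)]).
Context (H : set (CC R)) (connH : connected H) (HA : H `<=` ~` A) (clH : closure H z0).
Context (Az0 : A z0).

Lemma Re_l n z : (N0 <= n)%N -> modulus (z - z0) < D ->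
  Re (l n z) = ln (modulus (iter n f z)).
Proof. by move=> Nn zD; have [_ <- _] := lP Nn zD; rewrite mod_cexp expRK. Qed.

(** Harnack's inequality on the disc of radius [D / 2] about [w]. After division by [ln (r n)] this
    is the equicontinuity of the normalised logarithms. *)
Lemma l_oscillation n z w : (N0 <= n)%N -> modulus (w - z0) <= D / 5 ->
  modulus (z - w) <= D / 4 ->
  modulus (l n z - l n w) <= 8 * Re (l n w) * (modulus (z - w) / D).
Proof.
have D0' : 0 < D := D0.
move=> Nn wz zw.
have zw2 : modulus (z - w) < D / 2 by lra.
have D2 : 0 < D / 2 by lra.
have wD : modulus (w - z0) < D by lra.
have [_ _ lw0] := lP Nn wD.
have := @half_plane_harnack R (l n) w (D / 2) D2 _ z zw2.
move=> /(_ _)/wrap[u uw|].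
  have uD : modulus (u - z0) < D by have := mod_triangle u z0 w; lra.
  by have [] := lP Nn uD.
move: lw0 (mod_ge0 (z - w)) (mod_ge0 (l n z - l n w)).
move: (Re (l n w)) zw zw2; move: (modulus (z - w)) (modulus (l n z - l n w)) => s X p.
move=> zw zw2 p0 s0 X0 HX.
have : X * (D / 4) <= 2 * p * s.
  apply: le_trans HX; rewrite ler_wpM2l //; lra.
move=> Xs; rewrite mulrA ler_pdivlMr //; lra.
Qed.

Lemma l_harnack n z : (N0 <= n)%N -> modulus (z - z0) <= D / 5 ->
  modulus (l n z - l n z0) <= Re (l n z0) / 2.
Proof.
have D0' : 0 < D := D0.
move=> Nn zd; have zz : modulus (z0 - z0) < D by rewrite subrr mod0.
have [_ _ l0] := lP Nn zz; have zD : modulus (z - z0) < D by lra.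
have := @half_plane_harnack R (l n) z0 D D0 _ z zD.
move=> /(_ _)/wrap[u uD|]; first by have [] := lP Nn uD.
move: l0 (mod_ge0 (z - z0)) (mod_ge0 (l n z - l n z0)).
move: (Re (l n z0)) zd zD; move: (modulus (z - z0)) (modulus (l n z - l n z0)) => s X p.
move=> zw zw2 p0 s0 X0 HX.
suff : X * D <= p / 2 * D by rewrite ler_pM2r.
have : X * (4 / 5 * D) <= X * (D - s) by rewrite ler_wpM2l //; lra.
have : 2 * p * s <= 2 * p * (D / 5) by rewrite ler_wpM2l //; lra.
lra.
Qed.

Lemma near_point (d : R) : 0 < d -> exists2 w, H w & modulus (w - z0) < d.
Proof.
have D0' : 0 < D := D0.
move=> d0; have /clH[w [Hw wd]] : nbhs z0 [set w | modulus (w - z0) < d].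
  by apply/nbhs_modP; exists d.
by exists w.
Qed.

Lemma l_lower : exists N, forall n, (N <= n)%N -> forall z, modulus (z - z0) <= D / 5 ->
  ln (r n) / 2 <= Re (l n z).
Proof.
have D0' : 0 < D := D0.
have [N1 NP1] := ln_radius_large 0; exists (maxn N0 N1) => n; rewrite geq_max.
move=> /andP[Nn /NP1[n0 r1 _]] z zd.
have zz : modulus (z0 - z0) < D by rewrite subrr mod0.
have := AR_ln_ge n0 r1 Az0; rewrite -Re_l // => L.
have := l_harnack Nn zd; rewrite modBC => H1.
have := le_trans (ler_norm _) (le_trans (Re_le_mod _) H1); rewrite cReD cReN; lra.
Qed.

(** A crude bound: with [l_harnack] it keeps the normalised logarithms within distance 1 of their
    value at [z0], as [covers_disc] with [M = 1] requires. *)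
Lemma l_upper : exists N, forall n, (N <= n)%N -> Re (l n z0) <= 2 * ln (r n).
Proof.
have D0' : 0 < D := D0.
have D5 : 0 < D / 5 by lra.
have [w Hw wd] := near_point D5; have [N1 NP1] := not_AR_below (HA Hw).
have [N2 NP2] := ln_radius_large 0; exists (maxn N0 (maxn N1 N2)) => n; rewrite !geq_max.
move=> /and3P[Nn /NP1 xr /NP2[n0 r1 _]].
have := l_harnack Nn (ltW wd); rewrite modBC => H1.
have := le_trans (ler_norm _) (le_trans (Re_le_mod _) H1); rewrite cReD cReN.
have wD : modulus (w - z0) < D by lra.
have [_ E lw0] := lP Nn wD.
have : Re (l n w) <= ln (r n).
  rewrite Re_l // ler_ln ?posrE; [exact: ltW | by rewrite -E mod_cexp expR_gt0 | lra].
lra.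
Qed.

(* Equicontinuity turns the pointwise bound [|f^n w| < r_n] off [A] into an almost uniform one:
   test at one point near a cluster point of supposed counterexamples. *)
Lemma l_off_AR (e : R) : 0 < e -> exists N, forall n, (N <= n)%N ->
  forall z, modulus (z - z0) <= D / 5 -> ~ A z -> Re (l n z) < (1 + e) * ln (r n).
Proof.
have D0' : 0 < D := D0.
move=> e0; apply: contrapT => nbound.
have pick (j : nat) : exists p : nat * CC R, [/\ (j <= p.1)%N, modulus (p.2 - z0) <= D / 5,
    ~ A p.2 & (1 + e) * ln (r p.1) <= Re (l p.1 p.2)].
  apply: contrapT => nex; apply: nbound; exists j => n jn z zd nAz.
  by rewrite ltNge; apply/negP => Hz; apply: nex; exists (n, z).
have [p pP] := choice pick.
have [|zs [_ cls]] := @compact_disc R z0 (D / 5) ((fun j => (p j).2) @ \oo) _.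
  by exists 0%N => // j _ /=; have [] := pP j.
(* Two points within [be] of the cluster point are at most [D / 4] apart, as [l_oscillation] asks,
   and [2 * be / D <= e / 8] cancels its factor 8. *)
pose be := Num.min (D / 8) (e * D / 16).
have be0 : 0 < be by rewrite lt_min !divr_gt0 ?mulr_gt0.
have freq J : exists2 j, (J <= j)%N & modulus ((p j).2 - zs) < be.
  have F1 : ((fun j => (p j).2) @ \oo) [set w | exists2 j, (J <= j)%N & w = (p j).2].
    by exists J => // j /= Jj; exists j.
  have F2 : nbhs zs [set w | modulus (w - zs) < be] by apply/nbhs_modP; exists be.
  by have [w [[j Jj ->] jbe]] := cls _ _ F1 F2; exists j.
have [m _ mbe] := freq 0%N; have [_ mD nAm _] := pP m.
have [N1 NP1] := not_AR_below nAm; have [N2 NP2] := ln_radius_large 1.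
have [j Jj jbe] := freq (maxn N0 (maxn N1 N2)).
have [jn jD _ big] := pP j; set n := (p j).1 in jn big.
have : (maxn N0 (maxn N1 N2) <= n)%N by exact: leq_trans jn.
rewrite !geq_max => /and3P[Nn /NP1 xr /NP2[n0 r1 t1]].
have dist : modulus ((p j).2 - (p m).2) < 2 * be.
  by have := mod_triangle (p j).2 (p m).2 zs; rewrite [modulus (zs - _)]modBC; lra.
have be1 : be <= D / 8 by rewrite ge_min lexx.
have be2 : be <= e * D / 16 by rewrite ge_min lexx orbT.
have d4 : modulus ((p j).2 - (p m).2) <= D / 4 by lra.
have := l_oscillation Nn mD d4 => osc.
have := le_trans (ler_norm _) (le_trans (Re_le_mod _) osc); rewrite cReD cReN.
have wD : modulus ((p m).2 - z0) < D by lra.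
have [_ E lw0] := lP Nn wD.
have lm : Re (l n (p m).2) < ln (r n).
  rewrite Re_l // ltr_ln ?posrE //; [by rewrite -E mod_cexp expR_gt0 | lra].
have q1 : modulus ((p j).2 - (p m).2) / D <= e / 8.
  by rewrite ler_pdivrMr //; lra.
have q0 : 0 <= modulus ((p j).2 - (p m).2) / D by rewrite divr_ge0 ?mod_ge0 // ltW.
move: lw0 lm q0 q1 big; move: (modulus _ / D) (Re (l n (p m).2)) (Re (l n (p j).2)) (ln (r n)) t1.
move=> q a b t t1 a0 lm q0 q1 big.
have : 8 * a * q <= 8 * a * (e / 8) by rewrite ler_wpM2l //; lra.
have : a * e < t * e by rewrite ltr_pM2r.
lra.
Qed.

(** The point [z0] lies in [A], out of reach of [l_off_AR]; it is compared with a point of [H] close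
    to it. *)
Lemma l_z0_upper (e : R) : 0 < e -> exists N, forall n, (N <= n)%N ->
  Re (l n z0) < (1 + e) * ln (r n).
Proof.
have D0' : 0 < D := D0.
move=> e0; pose be := Num.min (D / 8) (e * D / 16).
have be0 : 0 < be by rewrite lt_min !divr_gt0 ?mulr_gt0.
have be1 : be <= D / 8 by rewrite ge_min lexx.
have be2 : be <= e * D / 16 by rewrite ge_min lexx orbT.
have [w Hw wd] := near_point be0; have [N1 NP1] := not_AR_below (HA Hw).
have [N2 NP2] := ln_radius_large 1; exists (maxn N0 (maxn N1 N2)) => n; rewrite !geq_max.
move=> /and3P[Nn /NP1 xr /NP2[n0 r1 t1]].
have wD5 : modulus (w - z0) <= D / 5 by lra.
have wD : modulus (w - z0) < D by lra.
have d4 : modulus (z0 - w) <= D / 4 by rewrite modBC; lra.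
have := l_oscillation Nn wD5 d4 => osc.
have := le_trans (ler_norm _) (le_trans (Re_le_mod _) osc); rewrite cReD cReN.
have [_ E lw0] := lP Nn wD.
have lm : Re (l n w) < ln (r n).
  rewrite Re_l // ltr_ln ?posrE //; [by rewrite -E mod_cexp expR_gt0 | lra].
have q1 : modulus (z0 - w) / D <= e / 8.
  by rewrite modBC ler_pdivrMr //; lra.
have q0 : 0 <= modulus (z0 - w) / D by rewrite divr_ge0 ?mod_ge0 // ltW.
move: lw0 lm q0 q1; move: (modulus _ / D) (Re (l n w)) (Re (l n z0)) (ln (r n)) t1.
move=> q a b t t1 a0 lm q0 q1.
have : 8 * a * q <= 8 * a * (e / 8) by rewrite ler_wpM2l //; lra.
have : a * e < t * e by rewrite ltr_pM2r.
lra.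
Qed.

Lemma iterate_covers_annulus : exists2 eta : R, 0 < eta & exists N, forall n, (N <= n)%N ->
  forall c, c != 0 -> (1 - eta) * ln (r n) <= ln (modulus c) <= (1 + 3 * eta) * ln (r n) ->
  exists2 z, modulus (z - z0) < D / 5 & iter n f z = c.
Proof.
have D0' : 0 < D := D0.
have D50 : 0 < D / 50 by lra.
have D5 : 0 < D / 5 by lra.
(* [covers_disc] is applied on the disc of radius [D / 5] and wants [w] within a tenth of that
   radius. *)
have [w Hw wd] := near_point D50.
have [e e0 [N1 NP1]] := relative_gap hf fnotpoly rho0 roo (HA Hw).
(* The radius given by [covers_disc] for [M = 1]. With [eta4] a quarter of it, the normalised
   logarithm of [c] differs from [h z0] by at most [3 * eta4] in real part and by less than [eta4]
   in imaginary part. *)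
pose eta0 : R := Num.min (Num.min 1 (e / 2)) (e ^+ 2 / (8 * (1 + 2))).
have [eta4 [eta40 etaE]] : exists x : R, 0 < x /\ x * 4 = eta0.
  exists (eta0 / 4); split; last by rewrite divfK.
  by rewrite divr_gt0 // !lt_min ltr01 !divr_gt0 // exprn_gt0.
have eta80 : 0 < eta4 / 2 by lra.
exists eta4 => //.
have [N2 NP2] := l_z0_upper eta80; have [N3 NP3] := l_upper.
have [N4 NP4] := ln_radius_large (1 + 2 * pi / eta4).
exists (maxn (maxn N0 N1) (maxn (maxn N2 N3) N4)) => n; rewrite !geq_max.
move=> /andP[/andP[Nn /NP1[_ xr gap]] /andP[/andP[/NP2 up /NP3 up2] /NP4[n0 r1 tbig]]] c c0 cP.
have zz : modulus (z0 - z0) < D by rewrite subrr mod0.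
have low := AR_ln_ge n0 r1 Az0; rewrite -Re_l // in low.
have pieta : 0 < 2 * pi / eta4 by rewrite divr_gt0 // mulr_gt0 // pi_gt0.
set t := ln (r n) in cP gap up up2 tbig low.
have t0 : 0 < t by lra.
pose h z := l n z * ((t^-1 : R)%:C : CC R).
have hB z u : h z - h u = (l n z - l n u) * ((t^-1 : R)%:C : CC R) by rewrite /h mulrBl.
have mt : modulus ((t^-1 : R)%:C : CC R) = t^-1 by rewrite modR gtr0_norm // invr_gt0.
have hP z : modulus (z - z0) < D / 5 -> hol h z /\ modulus (h z - h z0) <= 1.
  move=> zd; have zD : modulus (z - z0) < D by lra.
  have [hl _ _] := lP Nn zD; split; first exact: hol_mul hl (hol_cst _ _).
  rewrite hB modM mt ler_pdivrMr // mul1r.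
  by have := l_harnack Nn (ltW zd); lra.
have wd' : modulus (w - z0) <= D / 5 / 10 by lra.
have we : e <= modulus (h w - h z0).
  rewrite hB modM mt ler_pdivlMr // modBC.
  have wD : modulus (w - z0) < D by lra.
  apply: le_trans (le_trans (ler_norm _) (Re_le_mod _)); rewrite cReD cReN [Re (l n w)]Re_l //.
  lra.
(* The branch is chosen within [pi] of [Im (l n z0)], an error below [eta4 / 2] after division by
   [t]. *)
have [xi' [xiE xiRe xiIm]] := cexp_surj (Im (l n z0)) c0.
pose xi := xi' * ((t^-1 : R)%:C : CC R).
have := @covers_disc R h z0 w (D / 5) 1 e D5 e0 ler01 hP wd' we xi.
rewrite -/eta0 => /(_ _)/wrap[|[z zd hz]].
  rewrite /xi /h -mulrBl modM mt ltr_pdivrMr //.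
  apply: le_lt_trans (mod_le_ReIm _) _; rewrite cReD cReN cImD cImN xiRe.
  have tpi : 2 * pi < t * eta4 by rewrite -ltr_pdivrMr //; lra.
  have Ret : `|ln (modulus c) - Re (l n z0)| <= 3 * eta4 * t.
    by case/andP: cP => c1 c2; rewrite ler_norml; apply/andP; split; lra.
  rewrite -etaE; lra.
exists z => //; have zD : modulus (z - z0) < D by lra.
have [_ <- _] := lP Nn zD; rewrite -xiE; congr cexp.
have tC : ((t^-1 : R)%:C : CC R) != 0 by rewrite -mod_gt0 mt invr_gt0.
exact: (mulIf tC hz).
Qed.

Lemma hole_boundary_fatou : boundary H `<=` A -> boundary H `<=` fatou_set f.
Proof.
have D0' : 0 < D := D0.
move=> LA z Lz.
have [eta eta0 [N1 NP1]] := iterate_covers_annulus.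
have eta20 : 0 < 2 * eta by lra.
have [N2 NP2] := l_off_AR eta20.
have D50 : 0 < D / 50 by lra.
have [w Hw wd] := near_point D50.
have [N3 NP3] := not_AR_below (HA Hw).
have [N4 NP4] := ln_radius_large 1; have [N5 NP5] := l_lower.
have [n] : exists n, (maxn (maxn N0 N1) (maxn (maxn N2 N3) N4) <= n)%N by eexists.
rewrite !geq_max => /andP[/andP[Nn /NP1 cover] /andP[/andP[/NP2 off /NP3 xr] /NP4[n0 r1 t1]]].
set t := ln (r n) in cover off t1.
have rt : r n = expR t by rewrite lnK // posrE; lra.
have et0 : 0 < eta * t by rewrite mulr_gt0 //; lra.
pose ro := expR ((1 + 2 * eta) * t).
have ro0 : 0 < ro by exact: expR_gt0.
have cn u : {for u, continuous (fun v => modulus (iter n f v))}.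
  exact: cont_mod (hol_cont (hol_iter n u hf)).
have Hro u : H u -> modulus (iter n f u) < ro.
  move=> Hu; rewrite ltNge; apply/negP => big.
  have conn : connected ((fun v => modulus (iter n f v)) @` H).
    by apply: connected_continuous_connected => //; apply: continuous_subspaceT => v; exact: cn.
  have [v Hv fv] : ((fun v => modulus (iter n f v)) @` H) ro.
    apply: ((connected_intervalP _).1 conn (modulus (iter n f w)) (modulus (iter n f u))).
    - by exists w.
    - by exists u.
    - apply/andP; split; last exact: big.
      apply/ltW; apply: lt_le_trans xr _.
      by rewrite rt ler_expR; lra.
  have c0 : iter n f v != 0 by rewrite -mod_gt0 fv.
  have [|y yd fy] := cover _ c0.
    by rewrite fv expRK; apply/andP; split; lra.
  have yD : modulus (y - z0) < D by lra.
  (* [y] is mapped exactly onto the circle of radius [ro], where [off] allows no point outside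
     [A]. *)
  have Ay : A y.
    apply: contrapT => nAy; have := off y (ltW yd) nAy.
    by rewrite Re_l // fy fv expRK ltxx.
  by apply: (HA Hv); apply: (iter_eq_AR (esym fy)).
have zle : modulus (iter n f z) <= ro.
  have : closed [set u | modulus (iter n f u) <= ro].
    by apply: closed_le_fun => u; exact: cn.
  apply; case: Lz => clz _ V /clz[u [Hu Vu]]; exists u; split => //.
  exact/ltW/Hro.
have zge : r n <= modulus (iter n f z) by apply: LA.
pose lo := expR ((1 - eta) * t); pose hi := expR ((1 + 3 * eta) * t).
have lor : lo < r n by rewrite rt ltr_expR; lra.
have rohi : ro < hi by rewrite ltr_expR; lra.
(* The margins between [r n <= |.| <= ro], which contains the image of [z], and the covered annulus
   absorb the variation of [f^n] near [z]. *)
pose e := Num.min (r n - lo) (hi - ro).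
have e0 : 0 < e by rewrite lt_min !subr_gt0 lor.
have /contRP/(_ _ e0)[d d0 dP] := cn z.
apply: (@escape_fatou R f z d d0) => K.
have [N6 NP6] := ln_radius_large (2 * `|ln K|).
exists (maxn n (maxn N5 N6)) => m v; rewrite !geq_max => /and3P[nm N5m N6m] vd.
have := dP _ vd; rewrite lt_min !ltr_norml => /andP[/andP[v1 _] /andP[_ v2]].
have vlo : lo < modulus (iter n f v) by lra.
have vhi : modulus (iter n f v) < hi by lra.
have lo0 : 0 < lo by exact: expR_gt0.
have hi0 : 0 < hi by exact: expR_gt0.
have v0 : 0 < modulus (iter n f v) by lra.
have c0 : iter n f v != 0 by rewrite -mod_gt0.
have [|y yd fy] := cover _ c0.
  rewrite -[(1 - eta) * t]expRK -[(1 + 3 * eta) * t]expRK !ler_ln ?posrE ?expR_gt0 //.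
  by rewrite !ltW.
have yD : modulus (y - z0) < D by lra.
(* From time [n] on, the orbit of [v] is that of a point of the disc about [z0], where [l_lower]
   makes the iterates tend to infinity uniformly. *)
have -> : iter m f v = iter m f y.
  by rewrite -(subnK nm) !iterD fy.
have Nm := leq_trans Nn nm.
have [_ _ tm] := NP6 _ N6m.
have := NP5 _ N5m y (ltW yd); rewrite Re_l // => low.
have [K0|K0] := leP K 0; first by apply: le_trans K0 (mod_ge0 _).
have [_ E _] := lP Nm yD.
have y0 : 0 < modulus (iter m f y) by rewrite -E mod_cexp expR_gt0.
by rewrite -ler_ln ?posrE //; have := ler_norm (ln K); lra.
Qed.

End Near.

Lemma loop_dichotomy : let L := boundary (fundamental_hole f rho) in
  L `<=` fatou_set f \/ L `<=` julia_set f.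
Proof.
move=> L; have LA : L `<=` A by apply: boundary_component_sub; exact: closed_fast_escaping.
have [[z0 [Lz0 Fz0]]|none] := pselect (exists z0, L z0 /\ fatou_set f z0); last first.
  by right => z Lz Fz; apply: none; exists z.
left; have Az0 := LA _ Lz0.
have esc (K : R) : exists N, forall n, (N <= n)%N -> K <= modulus (iter n f z0).
  have [N NP] := ln_radius_large (ln (Num.max 1 K)); exists N => n /NP[n0 r1 KN].
  apply: le_trans (Az0 n n0).
  have : Num.max 1 K <= r n.
    by rewrite -ler_ln // posrE ?lt_max ?ltr01 //; lra.
  by rewrite ge_max => /andP[].
have [d d0 [N dP]] := fatou_escape hf Fz0 esc.
(* [hol_log] yields logarithms on a strictly smaller disc only; their real parts are positive
   because the iterates exceed 1 in modulus. *)
have D0 : 0 < d / 2 by lra.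
have Dd : d / 2 < d by lra.
have logs n : exists g : CC R -> CC R, (N <= n)%N ->
    forall z, modulus (z - z0) < d / 2 -> hol g z /\ cexp (g z) = iter n f z.
  have [Nn|Nn] := leqP N n; last by exists id.
  have [|g gP] := @hol_log R (iter n f) z0 d (d / 2) Dd.
    move=> z zd; split; first exact: hol_iter.
    by rewrite -mod_gt0; have := dP n z Nn zd; lra.
  by exists g => _.
have [l lP] := choice logs.
have lP' n : (N <= n)%N -> forall z, modulus (z - z0) < d / 2 ->
    [/\ hol (l n) z, cexp (l n z) = iter n f z & 0 < Re (l n z)].
  move=> Nn z zd; have [h1 h2] := lP n Nn z zd; split => //.
  have zd' : modulus (z - z0) < d by lra.
  have := dP n z Nn zd'; rewrite -h2 mod_cexp -expR0 ltr_expR; exact.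
apply: (hole_boundary_fatou D0 lP') => //.
- exact: component_connected.
- exact: connected_component_sub.
- by case: Lz0.
Qed.

End LoopInFatou.

Theorem theorem1p2 (R : realType) (f : CC R -> CC R) (L : set (CC R)) :
  transcendental_entire f -> is_fundamental_loop f L ->
  L `<=` fatou_set f \/ L `<=` julia_set f.
Proof.
move=> [ef fnotpoly] [rho [rho0 roo _ ->]].
have hf z : hol f z by apply: derivable_hol; exact: ef.
exact: loop_dichotomy.
Qed.
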